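(* Let $d\in\mathbb N$, $r>0$ and $\varepsilon>0$. Then $$K(r,\varepsilon)\ \ge\ \frac{2\varepsilon}{M_{2,d}\,r^2}.$$ Explicitly: let $0<\tau<\frac{2\varepsilon}{M_{2,d}r^2}$ and let $\mathcal A$ be any compact set of real $d\times d$ matrices, each having only real eigenvalues, with $\max_{A\in\mathcal A}\rho(A)\le r$. If $\rho(I+\tau\mathcal A)\ge 1$, then $\sigma(\mathcal A)\ge-\varepsilon$ (equivalently: if $\sigma(\mathcal A)<-\varepsilon$, then $\rho(I+\tau\mathcal A)<1$).
   Context: For a compact set $\mathcal A$ of real $d\times d$ matrices, a trajectory of the associated linear switching system is an absolutely continuous $x:[0,\infty)\to\mathbb R^d$ with $\dot x(t)=A(t)x(t)$ for almost every $t$, where $A(\cdot)$ is any Lebesgue measurable function from $[0,\infty)$ to $\mathcal A$. The (worst-case) Lyapunov exponent $\sigma(\mathcal A)$ is the infimum of all $\alpha\in\mathbb R$ such that for every trajectory $x$ there is a constant $C$ with $\|x(t)\|\le Ce^{\alpha t}$ for all $t\ge0$. For a bounded set of matrices $\mathcal M$, the joint spectral radius is $\rho(\mathcal M)=\lim_{k\to\infty}\sup_{M_1,\dots,M_k\in\mathcal M}\|M_1\cdots M_k\|^{1/k}$; for a single matrix, $\rho(A)$ is its spectral radius. $I+\tau\mathcal A=\{I+\tau A: A\in\mathcal A\}$. $K(r,\varepsilon)$ denotes the largest number such that for every $\tau\in(0,K(r,\varepsilon))$ and every compact set $\mathcal A$ of real $d\times d$ matrices with only real eigenvalues and $\max_{A\in\mathcal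 A}\rho(A)\le r$, the inequality $\rho(I+\tau\mathcal A)\ge1$ implies $\sigma(\mathcal A)\ge-\varepsilon$. Finally $M_{2,d}=\max\{\sup_{t\ge0}|p''(t)|: p(t)=e^{-t}q(t),\ q \text{ a real polynomial of degree}\le d-1,\ \sup_{t\ge 0}|p(t)|\le1\}$. *)

(* Defs.v *)
From mathcomp Require Import all_boot all_order all_algebra all_fingroup.
From Stdlib Require Import Reals.
Set Implicit Arguments. Unset Strict Implicit. Unset Printing Implicit Defensive.
Open Scope R_scope.

Notation mx d := ('M[R]_d) (only parsing).

Section Mx.
Variable d : nat.

Definition mxid : 'M[R]_d := \matrix_(i, j) (if i == j then R1 else R0).
Definition mxmul (A B : 'M[R]_d) : 'M[R]_d :=
  \matrix_(i, j) \big[Rplus/R0]_(k < d) (A i k * B k j).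
Definition mxprod (l : seq 'M[R]_d) : 'M[R]_d := foldr mxmul mxid l.
Definition I_plus (tau : R) (A : 'M[R]_d) : 'M[R]_d :=
  \matrix_(i, j) (mxid i j + tau * A i j).
Definition I_plus_set (tau : R) (Sx : 'M[R]_d -> Prop) : 'M[R]_d -> Prop :=
  fun B => exists A, Sx A /\ B = I_plus tau A.

(* Frobenius norm (all norms on matrices give the same JSR) *)
Definition frob (A : 'M[R]_d) : R :=
  sqrt (\big[Rplus/R0]_(i < d) \big[Rplus/R0]_(j < d) (A i j * A i j)).
Definition vnorm (v : 'I_d -> R) : R := sqrt (\big[Rplus/R0]_(i < d) (v i * v i)).

Definition det (A : 'M[R]_d) : R :=
  \big[Rplus/R0]_(s : 'S_d)
     ((if odd_perm s then -1 else 1) * \big[Rmult/R1]_(i < d) A i (s i)).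
Definition real_eigs (A : 'M[R]_d) (lam : 'I_d -> R) : Prop :=
  forall z : R, det (\matrix_(i, j) (z * mxid i j - A i j))
                = \big[Rmult/R1]_(i < d) (z - lam i).

Definition mx_compact (Sx : 'M[R]_d -> Prop) : Prop :=
  forall An : nat -> 'M[R]_d, (forall n, Sx (An n)) ->
  exists (phi : nat -> nat) (A : 'M[R]_d),
    (forall n, (phi n < phi (S n))%nat) /\ Sx A /\
    forall i j, Un_cv (fun n => An (phi n) i j) (A i j).

Definition sup_prod (Sx : 'M[R]_d -> Prop) (k : nat) (s : R) : Prop :=
  is_lub (fun y => exists l : seq 'M[R]_d,
             length l = k /\ (forall M, List.In M l -> Sx M) /\ y = frob (mxprod l)) s.
Definition kroot (x : R) (k : nat) : R :=
  if Req_EM_T x 0 then 0 else Rpower x (/ INR k).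
Definition jsr_is (Sx : 'M[R]_d -> Prop) (L : R) : Prop :=
  exists s : nat -> R, (forall k, sup_prod Sx (S k) (s k)) /\
    Un_cv (fun k => kroot (s k) (S k)) L.
End Mx.

Definition open_set (G : R -> Prop) : Prop :=
  forall x, G x -> exists delta, 0 < delta /\ forall y, Rabs (y - x) < delta -> G y.
Definition outer_le (E : R -> Prop) (e : R) : Prop :=
  exists a b : nat -> R, (forall n, a n <= b n) /\
    (forall t, E t -> exists n, a n < t < b n) /\
    (forall n, sum_f_R0 (fun k => b k - a k) n <= e).
Definition null_set (E : R -> Prop) : Prop := forall e, 0 < e -> outer_le E e.
Definition leb_measurable (E : R -> Prop) : Prop :=
  forall e, 0 < e -> exists G, open_set G /\ (forall t, E t -> G t) /\
                              outer_le (fun t => G t /\ ~ E t) e.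
Definition meas_fun (f : R -> R) : Prop :=
  forall c, leb_measurable (fun t => 0 <= t /\ c < f t).

Fixpoint intervals_in (lo hi : R) (l : list (R * R)) : Prop :=
  match l with
  | nil => True
  | (a, b) :: l' => lo <= a /\ a <= b /\ b <= hi /\ intervals_in b hi l'
  end.
Definition abs_cont (f : R -> R) : Prop :=
  forall T e, 0 < T -> 0 < e -> exists delta, 0 < delta /\
    forall l : list (R * R), intervals_in 0 T l ->
      List.fold_right (fun p acc => (snd p - fst p) + acc) 0 l < delta ->
      List.fold_right (fun p acc => Rabs (f (snd p) - f (fst p)) + acc) 0 l < e.

Section Traj.
Variable d : nat.
Definition switching (Sx : 'M[R]_d -> Prop) (A : R -> 'M[R]_d) : Prop :=
  (forall t, 0 <= t -> Sx (A t)) /\ forall i j, meas_fun (fun t => A t i j).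
Definition trajectory (Sx : 'M[R]_d -> Prop) (x : R -> 'I_d -> R) : Prop :=
  (forall i, abs_cont (fun t => x t i)) /\
  exists A, switching Sx A /\ exists N, null_set N /\
    forall t, 0 < t -> ~ N t -> forall i,
      derivable_pt_lim (fun s => x s i) t (\big[Rplus/R0]_(j < d) (A t i j * x t j)).
(* sigma(S) >= c : c is a lower bound of the set of admissible exponents *)
Definition lyap_ge (Sx : 'M[R]_d -> Prop) (c : R) : Prop :=
  forall alpha : R,
    (forall x, trajectory Sx x ->
       exists C, forall t, 0 <= t -> vnorm (x t) <= C * exp (alpha * t)) ->
    c <= alpha.
End Traj.

(* the set of values |p''(t)|, t >= 0, p = e^{-t} q, deg q <= d-1, sup_{t>=0}|p| <= 1;
   M_{2,d} is its least upper bound *)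
Definition M2_set (d : nat) (y : R) : Prop :=
  exists c : 'I_d -> R,
    let p := fun t : R => exp (- t) * \big[Rplus/R0]_(i < d) (c i * pow t i) in
    (forall t, 0 <= t -> Rabs (p t) <= 1) /\
    exists (t : R) (p1 : R -> R) (l : R), 0 <= t /\
      (forall s, derivable_pt_lim p s (p1 s)) /\ derivable_pt_lim p1 t l /\ y = Rabs l.

(* Main.v *)
(** If [alpha < -eps] is an admissible exponent, then the products of the flows
    [exp (eps h) exp (h A)], [A] in the set, are uniformly bounded: otherwise,
    starting at a point with unbounded orbits, one never reaches a point with
    bounded orbits, and concatenation gives a trajectory violating the decay.
    Let [|x|] be the supremum of the moduli of the coordinates of [P x] over all
    these products [P].  For such a coordinate, [q(t) = (P exp (t (A + eps)) x)_i] is bounded by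
    [|x|] and solves a linear equation with real exponents in [-(r - eps), 0).
    The comparison theorem says that [|q''|] is then at most
    [M2 (r - eps)^2 |x|], the bound for the exponent [-(r - eps)] of full
    multiplicity.  Taylor's formula at a step [sigma] gives
    [|x + sigma (A + eps) x| <= (1 + sigma^2 M2 (r - eps)^2 / 2) |x|], and
    [I + tau A] is a contraction once [tau = sigma / (1 + sigma eps)].
    This step uses [M2 >= 2], hence [d >= 2]; for [d = 1] the contraction is explicit.

    The comparison theorem replaces one exponent [-a] by [-rho], [rho > a], at a
    time.  By Helly's theorem it is enough to bound the function with the larger
    rate at [d] points and there, by counting alternations, the function that
    interpolates [1, -1, 1, ...] has the largest second derivative at [0]. *)
Require Import Defs.
From mathcomp Require Import all_boot all_order all_algebra all_fingroup.
From Stdlib Require Import Reals Lra Lia FunctionalExtensionality Classical IndefiniteDescription.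
From mathcomp Require Import Rstruct.
From Coquelicot Require Import Coquelicot.
Set Implicit Arguments. Unset Strict Implicit. Unset Printing Implicit Defensive.
Open Scope R_scope.

(** * Functions annihilated by products of operators [D + a] *)

(** The contraction comes from the discount: [I + sigma (A + eps) = (1 + sigma eps) (I + tau A)], so
    a Taylor loss of order [sigma^2] competes with a gain of order [sigma]. The shift by [eps] also
    lowers the largest rate from [r] to [r - eps], and this saving pays for the passage from [sigma]
    to the smaller [tau]. The strict gap [alpha < - eps] makes every shifted rate positive.
    Solutions then vanish at infinity, and the alternation count relies on that. The obstacle is the
    comparison of rates: an extremal function on the half-line, with repeated rates allowed, would
    call for an equioscillation theory. Instead [|Q| <= 1] is imposed on a finite grid only, where
    Helly's theorem leaves an interpolation problem. Coefficient bounds that do not depend on the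
    grid then give [|Q| <= 1 + eta] on the half-line, and [eta] tends to 0. *)

Definition derives (f f' : R -> R) : Prop := forall t, is_derive f t (f' t).

Lemma is_derive_eq (f : R -> R) (x l l' : R) :
  is_derive f x l -> l = l' -> is_derive f x l'.
Proof. by move=> h <-. Qed.

Lemma derives_lin (c1 c2 : R) (f g f' g' : R -> R) : derives f f' -> derives g g' ->
  derives (fun t => c1 * f t + c2 * g t) (fun t => c1 * f' t + c2 * g' t).
Proof.
move=> hf hg t; apply: is_derive_plus; apply: is_derive_scal; [exact: hf | exact: hg].
Qed.

Lemma derives_mul (f g f' g' : R -> R) : derives f f' -> derives g g' ->
  derives (fun t => f t * g t) (fun t => f' t * g t + f t * g' t).
Proof.
move=> hf hg t.
exact: (is_derive_mult f g t _ _ (hf t) (hg t) (fun x y => Rmult_comm x y)).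
Qed.

Lemma derives_exp (a : R) : derives (fun t => exp (a * t)) (fun t => a * exp (a * t)).
Proof. by move=> t; auto_derive => //; ring. Qed.

Lemma derives_mvt (f f' : R -> R) (a b : R) : derives f f' -> a < b ->
  exists2 c, a < c < b & f b - f a = f' c * (b - a).
Proof.
move=> df ab.
have [c _|c [h1 h2]] := MVT_cor2 f f' a b ab; first by apply/is_derive_Reals; exact: df.
by exists c.
Qed.

Lemma derives_uniq (f f1 f2 : R -> R) : derives f f1 -> derives f f2 -> f1 = f2.
Proof.
move=> h1 h2; apply: functional_extensionality => t.
by rewrite -(is_derive_unique _ _ _ (h1 t)) -(is_derive_unique _ _ _ (h2 t)).
Qed.

Lemma derives0_const (f : R -> R) : derives f (fun=> 0) -> forall s t, f s = f t.
Proof.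
have aux s t : derives f (fun=> 0) -> s < t -> f s = f t.
  by move=> df st; have [c _] := derives_mvt df st; lra.
move=> df s t; case: (Rtotal_order s t) => [|[->//|]] st; first exact: aux.
by symmetry; exact: aux.
Qed.

Lemma derives_shift (f f' : R -> R) (s : R) : derives f f' ->
  derives (fun t => f (t + s)) (fun t => f' (t + s)).
Proof.
move=> df t.
have := is_derive_comp f (fun t => t + s) t _ 1 (df (t + s)).
rewrite /scal /= /mult /= Rmult_1_l; apply.
by auto_derive => //; ring.
Qed.

(* [chain [:: a1; ...; ak] f g] means [(D + ak) ... (D + a1) f = g]; the auxiliary
   [f1] below is [(D + a) f]. *)
Fixpoint chain (l : seq R) (f g : R -> R) : Prop :=
  if l is a :: l' then
    exists2 f1, derives f (fun t => f1 t - a * f t) & chain l' f1 g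
  else f = g.

Lemma chain_eq (l : seq R) (f f' g g' : R -> R) :
  chain l f g -> f =1 f' -> g =1 g' -> chain l f' g'.
Proof. by move=> h /functional_extensionality <- /functional_extensionality <-. Qed.

(* The solutions are the combinations of [t^j exp (- a t)]: the members of [l] are
   decay rates, counted with multiplicity. *)
Definition expsol (l : seq R) (f : R -> R) : Prop := chain l f (fun=> 0).

Lemma chain_lin (l : seq R) (c1 c2 : R) : forall f1 f2 g1 g2 : R -> R,
  chain l f1 g1 -> chain l f2 g2 ->
  chain l (fun t => c1 * f1 t + c2 * f2 t) (fun t => c1 * g1 t + c2 * g2 t).
Proof.
elim: l => [|a l IH] f1 f2 g1 g2 /=; first by move=> -> ->.
move=> [k1 d1 h1] [k2 d2 h2]; exists (fun t => c1 * k1 t + c2 * k2 t); last exact: IH.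
move=> t; apply: is_derive_eq (derives_lin c1 c2 d1 d2 t) _; ring.
Qed.

Lemma expsol_lin (l : seq R) (c1 c2 : R) (f1 f2 : R -> R) :
  expsol l f1 -> expsol l f2 -> expsol l (fun t => c1 * f1 t + c2 * f2 t).
Proof.
move=> h1 h2; by apply: chain_eq (chain_lin c1 c2 h1 h2) _ _ => t //; ring.
Qed.

Lemma expsol0 (l : seq R) : expsol l (fun=> 0).
Proof.
elim: l => [|a l IH] //=; exists (fun=> 0) => // t.
by auto_derive => //; ring.
Qed.

Lemma chain_deriv (l : seq R) : forall f g g' : R -> R,
  chain l f g -> derives g g' -> exists2 f', derives f f' & chain l f' g'.
Proof.
elim: l => [|a l IH] f g g' /=; first by move=> -> dg; exists g'.
move=> [f1 df h1] dg; have [f1' df1 h1'] := IH _ _ _ h1 dg.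
exists (fun t => f1 t - a * f t) => //; exists f1' => // t.
exact: (is_derive_minus f1 (fun t => a * f t) _ _ _ (df1 t) (is_derive_scal _ _ a _ (df t))).
Qed.

Lemma expsol_deriv (l : seq R) (f : R -> R) : expsol l f ->
  exists2 f', derives f f' & expsol l f'.
Proof. by move=> h; apply: chain_deriv h _ => t; auto_derive. Qed.

Lemma chain_cat (l1 l2 : seq R) : forall f h g : R -> R,
  chain l1 f h -> chain l2 h g -> chain (l1 ++ l2) f g.
Proof.
elim: l1 => [|a l1 IH] f h g /=; first by move=> ->.
by move=> [f1 df h1] h2; exists f1 => //; exact: IH h2.
Qed.

Lemma chain_catP (l1 l2 : seq R) : forall f g : R -> R,
  chain (l1 ++ l2) f g -> exists2 h, chain l1 f h & chain l2 h g.
Proof.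
elim: l1 => [|a l1 IH] f g /=; first by exists f.
by move=> [f1 df /IH [h h1 h2]]; exists h => //; exists f1.
Qed.

Lemma expsol_shift (l : seq R) (s : R) : forall f : R -> R,
  expsol l f -> expsol l (fun t => f (t + s)).
Proof.
elim: l => [|a l IH] f /=; first by rewrite /expsol /= => ->.
by move=> [f1 df /IH h1]; exists (fun t => f1 (t + s)) => //; exact: (derives_shift s df).
Qed.

(** What the operators of [l] leave of [f] becomes constant after multiplication by [exp (a t)]. The
    comparison of rates reads off the sign of [C]. *)
Lemma expsol_rcons (l : seq R) (a : R) (f : R -> R) : expsol (rcons l a) f ->
  exists C, chain l f (fun t => C * exp (- a * t)).
Proof.
rewrite -cats1 => /chain_catP [h hf /= [h1 dh e1]]; exists (h 0).
suff -> : (fun t => h 0 * exp (- a * t)) = h by [].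
apply: functional_extensionality => t.
have dF : derives (fun t => exp (a * t) * h t) (fun=> 0).
  move=> u; apply: is_derive_eq (derives_mul (derives_exp a) dh u) _; rewrite e1; ring.
have := derives0_const dF t 0; rewrite Rmult_0_r exp_0 Rmult_1_l => <-.
rewrite Rmult_assoc (Rmult_comm (h t)) -Rmult_assoc -exp_plus.
have -> : a * t + - a * t = 0 by ring.
by rewrite exp_0; ring.
Qed.

(** The operators of [l] send [f] to [C exp (- a t)] and [f'] to [- a C exp (- a t)], hence
    [f' + a f] to 0. *)
Lemma expsol_rot (l : seq R) (a : R) (f : R -> R) :
  expsol (rcons l a) f -> expsol (a :: l) f.
Proof.
move=> /expsol_rcons [C h].
have [|f' df h'] := @chain_deriv _ _ _ (fun t => - a * (C * exp (- a * t))) h.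
  move=> t; apply: is_derive_eq (is_derive_scal _ _ C _ (derives_exp (- a) t)) _; ring.
exists (fun t => 1 * f' t + a * f t).
  by move=> t; apply: is_derive_eq (df t) _; ring.
by apply: chain_eq (chain_lin 1 a h' h) _ _ => t //; ring.
Qed.

(** * Counting alternations *)

(* [f] takes the signs [s, -s, s, ...] at [n] increasing points beyond [lo].  Rolle's
   theorem in this form needs no multiplicities: each operator [D + a] costs exactly
   one alternation. *)
Fixpoint alt (f : R -> R) (s lo : R) (n : nat) : Prop :=
  if n is n'.+1 then exists2 y, lo < y & 0 < s * f y /\ alt f (- s) y n' else True.

Lemma alt_mono (f : R -> R) (s lo lo' : R) (n : nat) :
  lo' <= lo -> alt f s lo n -> alt f s lo' n.
Proof. by case: n => [|n] //= h [y hy hh]; exists y => //; lra. Qed.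

Lemma alt_pos (p f : R -> R) (n : nat) : (forall t, 0 < p t) -> forall s lo,
  alt f s lo n -> alt (fun t => p t * f t) s lo n.
Proof.
move=> hp; elim: n => [|n IH] //= s lo [y hy [h1 h2]]; exists y => //; split; last exact: IH.
by have := Rmult_lt_0_compat _ _ (hp y) h1; lra.
Qed.

Lemma alt_deriv1 (f f' : R -> R) (s x y : R) : derives f f' -> x < y ->
  s * f y < s * f x -> exists2 z, x < z < y & 0 < - s * f' z.
Proof.
move=> df xy h; have [z hz e] := derives_mvt df xy; exists z => //.
have e2 : (- s * f' z) * (y - x) = - s * (f y - f x) by rewrite e; ring.
by apply: (Rmult_lt_reg_r (y - x)); lra.
Qed.

Lemma alt_deriv (f f' : R -> R) (n : nat) : derives f f' -> forall s y0,
  0 < s * f y0 -> alt f (- s) y0 n -> alt f' (- s) y0 n.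
Proof.
move=> df; elim: n => [|n IH] s y0 h0 //= [y1 h1 [h2 h3]].
have [|z hz hz'] := @alt_deriv1 f f' s y0 y1 df h1; first by lra.
exists z; first by lra.
split => //; apply: (@alt_mono _ _ y1); first by lra.
exact: IH.
Qed.

Definition vanishing (f : R -> R) : Prop :=
  forall e, 0 < e -> exists T, forall t, T <= t -> Rabs (f t) < e.

(* Vanishing at infinity gives back the alternation that differentiation loses. *)
Lemma alt_deriv_vanishing (f f' : R -> R) (n : nat) : derives f f' -> vanishing f ->
  forall s y0, 0 < s * f y0 -> alt f (- s) y0 n -> alt f' (- s) y0 n.+1.
Proof.
move=> df vf; elim: n => [|n IH] s y0 h0 /=.
  (* Beyond [T] the function is smaller in modulus than at [y0], so [s * f] has to decrease
     somewhere in between. *)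
  have [|T hT] := vf (Rabs (f y0)).
    by apply: Rabs_pos_lt => e; rewrite e in h0; lra.
  move=> _; set y1 := Rmax T (y0 + 1).
  have y01 : y0 < y1 by have := Rmax_r T (y0 + 1); rewrite -/y1; lra.
  have [|z hz hz'] := @alt_deriv1 f f' s y0 y1 df y01; last first.
    by exists z => //; lra.
  have h1 := hT y1 (Rmax_l _ _).
  apply: (Rle_lt_trans _ (Rabs (s * f y1))); first exact: Rle_abs.
  rewrite -(Rabs_pos_eq (s * f y0)); last by lra.
  rewrite !Rabs_mult; apply: Rmult_lt_compat_l => //.
  by apply: Rabs_pos_lt => e; rewrite e in h0; lra.
move=> [y1 h1 [h2 h3]].
have [|z hz hz'] := @alt_deriv1 f f' s y0 y1 df h1; first by lra.
exists z; first by lra.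
split => //; apply: (@alt_mono _ _ y1 z n.+1); first by lra.
exact: IH.
Qed.

(** [D + a] is [D] conjugated by [exp (a t)], and positive factors preserve alternations. Rolle
    drops the first point, so each operator flips the leading sign. *)
Lemma alt_chain (l : seq R) (n : nat) : forall (f g : R -> R) (s lo : R),
  chain l f g -> alt f s lo (size l + n) -> alt g (iter (size l) Ropp s) lo n.
Proof.
elim: l => [|a l IH] f g s lo /=; first by move=> ->.
move=> [f1 df h1] [y hy [hs ha]].
have pos t : 0 < exp (a * t) by exact: exp_pos.
have pos' t : 0 < exp (- a * t) by exact: exp_pos.
change (alt g (iter (size l).+1 Ropp s) lo n); rewrite iterSr; apply: IH h1 _.
have -> : f1 = fun t => exp (- a * t) * (exp (a * t) * f1 t).
  apply: functional_extensionality => t; rewrite -Rmult_assoc -exp_plus.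
  have -> : - a * t + a * t = 0 by ring.
by rewrite exp_0; ring.
apply: (alt_pos pos'); apply: (@alt_mono _ _ y); first by lra.
apply: (@alt_deriv (fun t => exp (a * t) * f t)).
- by move=> t; apply: is_derive_eq (derives_mul (derives_exp a) df t) _; ring.
- by have := Rmult_lt_0_compat _ _ (pos y) hs; lra.
- exact: alt_pos.
Qed.

Fixpoint zer (f : R -> R) (lo : R) (n : nat) : Prop :=
  if n is n'.+1 then exists2 y, lo < y & f y = 0 /\ zer f y n' else True.

Lemma zer_deriv (f f' : R -> R) (n : nat) : derives f f' -> forall y0,
  f y0 = 0 -> zer f y0 n -> zer f' y0 n.
Proof.
move=> df; elim: n => [|n IH] y0 h0 //= [y1 h1 [h2 h3]].
have [z hz e] := derives_mvt df h1; exists z; first by lra.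
split.
  by apply: (Rmult_eq_reg_r (y1 - y0)); [rewrite -e; lra | lra].
have := IH y1 h2 h3; case: n {IH h3} => [|n] //= [w hw hw']; exists w => //; lra.
Qed.

Lemma zer_mul (p f : R -> R) (n : nat) : forall lo,
  zer f lo n -> zer (fun t => p t * f t) lo n.
Proof.
elim: n => [|n IH] //= lo [y hy [h1 h2]]; exists y => //; split; last exact: IH.
by rewrite h1; ring.
Qed.

(** The Chebyshev property: as many zeros as rates force the zero function. It makes interpolation
    at [size l] points solvable. *)
Lemma zer_expsol (l : seq R) : forall (f : R -> R) lo,
  expsol l f -> zer f lo (size l) -> f = fun=> 0.
Proof.
elim: l => [|a l IH] f lo //= [f1 df h1] [y hy [hs hz]].
have dF : derives (fun t => exp (a * t) * f t) (fun t => exp (a * t) * f1 t).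
  by move=> t; apply: is_derive_eq (derives_mul (derives_exp a) df t) _; ring.
have ez : zer f1 y (size l).
  have -> : f1 = fun t => exp (- a * t) * (exp (a * t) * f1 t).
    apply: functional_extensionality => t; rewrite -Rmult_assoc -exp_plus.
    have -> : - a * t + a * t = 0 by ring.
by rewrite exp_0; ring.
  apply: zer_mul; apply: (zer_deriv dF); first by rewrite hs; ring.
  exact: zer_mul.
have f10 := IH _ _ h1 ez; rewrite f10 in dF.
apply: functional_extensionality => t.
have dF0 : derives (fun t => exp (a * t) * f t) (fun=> 0).
  by move=> u; apply: is_derive_eq (dF u) _; ring.
have := derives0_const dF0 t y; rewrite hs Rmult_0_r.
have := exp_pos (a * t) => h /Rmult_integral [|//]; lra.
Qed.

Lemma expsol_decay (l : seq R) (delta : R) : (forall a, a \in l -> delta < a) ->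
  forall f, expsol l f ->
  exists C, forall t, 0 <= t -> Rabs (f t) <= C * exp (- delta * t).
Proof.
elim: l => [|a l IH] hl f /=.
  by rewrite /expsol /= => ->; exists 0 => t _; rewrite Rabs_R0; lra.
move=> [f1 df h1]; have [|C hC] := IH _ f1 h1.
  by move=> b hb; apply: hl; rewrite inE hb orbT.
have ad : delta < a by apply: hl; rewrite inE eqxx.
have C0 : 0 <= C.
  have := hC 0 (Rle_refl 0); rewrite Rmult_0_r exp_0.
  by have := Rabs_pos (f1 0); lra.
(* Chosen so that [K exp ((a - delta) t)] has derivative [C exp ((a - delta) t)], which dominates
   the derivative [exp (a t) f1] of [exp (a t) f]. *)
pose K := C / (a - delta).
have K0 : 0 <= K by apply: Rdiv_le_0_compat; lra.
have key s : s = 1 \/ s = -1 -> forall t, 0 <= t ->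
    s * f t <= (Rabs (f 0) + K) * exp (- delta * t).
  move=> hs t ht.
  have dF : derives (fun t => 1 * (exp (a * t) * (s * f t + 0 * f t)) + - K * exp ((a - delta) * t))
                  (fun t => exp (a * t) * (s * f1 t - C * exp (- delta * t))).
    move=> u; apply: is_derive_eq (derives_lin 1 (- K)
      (derives_mul (derives_exp a) (derives_lin s 0 df df)) (derives_exp (a - delta)) u) _.
    have e1 : exp ((a - delta) * u) = exp (a * u) * exp (- delta * u).
      by rewrite -exp_plus; congr exp; ring.
    have e2 : C = K * (a - delta) by rewrite /K; field; lra.
    by rewrite e2 e1; ring.
  have dec : exp (a * t) * (s * f t) - K * exp ((a - delta) * t) <= s * f 0 - K.
    case: ht => [ht|<-]; last by rewrite !Rmult_0_r exp_0; lra.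
    have [c hc] := derives_mvt dF ht; rewrite !Rmult_0_r exp_0 !Rmult_1_l Rmult_1_r => e.
    have hc1 : s * f1 c <= C * exp (- delta * c).
      have := hC c ltac:(lra); move: (Rle_abs (f1 c)) (Rle_abs (- f1 c)); rewrite Rabs_Ropp.
      by case: hs => ->; lra.
    have : exp (a * c) * (s * f1 c - C * exp (- delta * c)) * (t - 0) <= 0.
      have := exp_pos (a * c) => hp.
      have : 0 <= exp (a * c) * (C * exp (- delta * c) - s * f1 c) * (t - 0).
        by apply: Rmult_le_pos; [apply: Rmult_le_pos|]; lra.
      lra.
    lra.
  have e1 : exp (a * t) * exp (- delta * t) = exp ((a - delta) * t).
    by rewrite -exp_plus; congr exp; ring.
  apply: (Rmult_le_reg_l (exp (a * t))); first exact: exp_pos.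
  have -> : exp (a * t) * ((Rabs (f 0) + K) * exp (- delta * t)) =
            (Rabs (f 0) + K) * exp ((a - delta) * t) by rewrite -e1; ring.
  have h1e : 1 <= exp ((a - delta) * t).
    have : 0 <= (a - delta) * t by apply: Rmult_le_pos; lra.
    by have := exp_ineq1_le ((a - delta) * t); lra.
  have hs0 : s * f 0 <= Rabs (f 0).
    move: (Rle_abs (f 0)) (Rle_abs (- f 0)); rewrite Rabs_Ropp.
    by case: hs => ->; lra.
  have := Rmult_le_compat_l _ _ _ (Rabs_pos (f 0)) h1e; lra.
exists (Rabs (f 0) + K) => t ht.
have k1 := key 1 (or_introl erefl) t ht; have k2 := key (-1) (or_intror erefl) t ht.
by apply: Rabs_le; lra.
Qed.

Lemma decay_vanishing (f : R -> R) (C delta : R) : 0 < delta ->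
  (forall t, 0 <= t -> Rabs (f t) <= C * exp (- delta * t)) -> vanishing f.
Proof.
move=> d0 h e e0; exists (Rabs C / (delta * e)).
have hC := Rabs_pos C.
move=> t ht; have ht0 : 0 <= t.
  apply: Rle_trans ht; apply: Rdiv_le_0_compat => //; exact: Rmult_lt_0_compat.
apply: Rle_lt_trans (h t ht0) _.
have h1 := exp_ineq1_le (delta * t).
have h2 : exp (delta * t) * exp (- delta * t) = 1.
  rewrite -exp_plus; have -> : delta * t + - delta * t = 0 by ring.
exact: exp_0.
have h3 : C * exp (- delta * t) <= Rabs C * exp (- delta * t).
  by apply: Rmult_le_compat_r; [exact: Rlt_le (exp_pos _) | exact: Rle_abs].
apply: Rle_lt_trans h3 _.
apply: (Rmult_lt_reg_r (exp (delta * t))); first exact: exp_pos.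
have -> : Rabs C * exp (- delta * t) * exp (delta * t) = Rabs C.
  by rewrite Rmult_assoc (Rmult_comm (exp (- delta * t))) h2; ring.
have h4 : Rabs C <= e * (delta * t).
  have : Rabs C / (delta * e) * (delta * e) <= t * (delta * e).
    apply: Rmult_le_compat_r => //; apply: Rlt_le; exact: Rmult_lt_0_compat.
  have -> : Rabs C / (delta * e) * (delta * e) = Rabs C by field; lra.
  lra.
have : e * (delta * t) < e * exp (delta * t) by apply: Rmult_lt_compat_l => //; lra.
lra.
Qed.

(** * Helly's theorem *)

Section Helly.
Import Order.TTheory GRing.Theory Num.Theory.
Local Open Scope ring_scope.

(** More than [d + 1] vectors [(x i, 1)] in dimension [d + 1] are linearly dependent; negating the
    relation if necessary produces a positive weight. *)
Lemma radon (F : realFieldType) (d n : nat) (x : 'I_n -> 'rV[F]_d) : (d.+1 < n)%nat ->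
  exists w : 'I_n -> F,
    [/\ \sum_i w i = 0, \sum_i w i *: x i = 0 & exists i, 0 < w i].
Proof.
move=> dn; pose M := \matrix_i row_mx (x i) (1%:M : 'M_1) : 'M[F]_(n, d + 1).
have /rowV0Pn [v /sub_kermxP vM v0] : kermx M != 0.
  rewrite kermx_eq0 -row_leq_rank -ltnNge.
  by apply: leq_ltn_trans (rank_leq_col _) _; rewrite addn1.
have key (u : 'rV_n) : u *m M = 0 -> \sum_i u 0 i = 0 /\ \sum_i u 0 i *: x i = 0.
  rewrite mulmx_sum_row => e; split.
    have := congr1 (fun z => rsubmx z 0 0) e; rewrite !mxE summxE => e1; rewrite -[RHS]e1.
    by apply: eq_bigr => i _; rewrite rowK !mxE (unsplitK (inr _)) !mxE mulr1.
  apply/rowP => j; have := congr1 (fun z => lsubmx z 0 j) e; rewrite !mxE !summxE => e1; rewrite -[RHS]e1.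
  apply: eq_bigr => i _.
  by rewrite rowK !mxE (unsplitK (inl _)).
have [i vi] : exists i, v 0 i != 0.
  by apply/existsP; apply: contraNT v0 => /existsPn h; apply/eqP/rowP => i; rewrite mxE; apply/eqP; rewrite -[_ == _]negbK h.
have [lt0|gt0|e] := ltgtP (v 0 i) 0.
- have [] := key (- v); first by rewrite mulNmx vM oppr0.
  by exists (fun i => (- v) 0 i); split => //; exists i; rewrite mxE oppr_gt0.
- by have [] := key v vM; exists (fun i => v 0 i); split => //; exists i.
- by rewrite e eqxx in vi.
Qed.

(** Membership is asked only where the weight is nonzero: in Helly's proof the point with index [k]
    may violate the constraint [k], and it then has weight 0. *)
Definition convex_pred (F : realFieldType) (d : nat) (C : 'rV[F]_d -> Prop) : Prop :=
  forall n (w : 'I_n -> F) (x : 'I_n -> 'rV[F]_d),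
    (forall k, 0 <= w k) -> \sum_k w k = 1 -> (forall k, w k != 0 -> C (x k)) ->
    C (\sum_k w k *: x k).

(** Induction on the number of constraints. Let [x k] satisfy all but the [k]-th. The positive and
    the negative part of a Radon relation have the same barycentre, and for each constraint one of
    the two parts gives weight 0 to the point that may violate it. *)
Lemma helly (F : realFieldType) (d : nat) (I : finType) (C : I -> 'rV[F]_d -> Prop) :
  (forall i, convex_pred (C i)) ->
  (forall B : {set I}, (#|B| <= d.+1)%nat -> exists x, forall i, i \in B -> C i x) ->
  exists x, forall i, C i x.
Proof.
move=> cvxC hB.
suff H m : forall A : {set I}, #|A| = m -> exists x, forall i, i \in A -> C i x.
  by have [x hx] := H _ [set: I] erefl; exists x => i; apply: hx; rewrite inE.
elim/ltn_ind: m => m IH A cA.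
have [|dm] := leqP m d.+1; first by rewrite -cA; exact: hB.
have /fin_all_exists [x hx] (k : 'I_#|A|) :
    exists x, forall i, i \in A :\ enum_val k -> C i x.
  apply: (IH #|A :\ enum_val k|) => //.
  by rewrite -cA [#|A|](cardsD1 (enum_val k)) enum_valP add1n ltnS.
have [|w [sw swx [i0 wi0]]] := radon x; first by rewrite cA.
pose wp i := Num.max (w i) 0; pose wn i := Num.max (- w i) 0.
have wE i : w i = wp i - wn i.
  by rewrite /wp /wn; case: (leP (w i) 0) => h;
    case: (leP (- w i) 0) => h'; rewrite ?subr0 ?sub0r ?opprK //;
    move: h'; rewrite ?oppr_le0 ?oppr_gt0 => h'; apply/eqP; rewrite eq_le ?h ?h' ?(ltW h) ?(ltW h') //;
    have := lt_trans h h'; rewrite ltxx.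
have wp0 i : 0 <= wp i by rewrite /wp le_max lexx orbT.
have wn0 i : 0 <= wn i by rewrite /wn le_max lexx orbT.
pose S := \sum_i wp i.
have S0 : 0 < S.
  rewrite /S (bigD1 i0) //=; apply: ltr_pwDl; last by apply: sumr_ge0.
  by rewrite /wp lt_max wi0.
have Sn : \sum_i wn i = S.
  apply/eqP; rewrite eq_sym -subr_eq0 /S -sumrB -[X in _ == X]sw.
  by apply/eqP/eq_bigr => i _; rewrite wE.
have px : \sum_i wn i *: x i = \sum_i wp i *: x i.
  apply/eqP; rewrite eq_sym -subr_eq0 -sumrB -[X in _ == X]swx.
  by apply/eqP/eq_bigr => i _; rewrite wE scalerBl.
have combo (u : 'I_#|A| -> F) : (forall i, 0 <= u i) -> \sum_i u i = S ->
    forall i, i \in A -> (forall k, u k != 0 -> i != enum_val k) ->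
    C i (\sum_k (u k / S) *: x k).
  move=> u0 us i iA hu; apply: cvxC.
  - by move=> k; rewrite divr_ge0 // ltW.
  - by rewrite -mulr_suml us divff // gt_eqF.
  - move=> k; rewrite mulf_eq0 negb_or => /andP [/hu ik _]; apply: hx.
    by rewrite !inE ik.
exists (\sum_k (wp k / S) *: x k) => i iA.
pose j := enum_rank_in iA i; have ij : enum_val j = i by rewrite enum_rankK_in.
have [wj|wj] := leP (w j) 0.
  apply: combo => // k wk; apply: contraNneq wk => e.
  have -> : k = j by apply: enum_val_inj; rewrite ij.
  by rewrite /wp; apply/eqP/max_idPr.
have -> : \sum_k (wp k / S) *: x k = \sum_k (wn k / S) *: x k.
  transitivity (S^-1 *: \sum_k wp k *: x k).
    by rewrite scaler_sumr; apply: eq_bigr => k _; rewrite scalerA mulrC.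
  by rewrite -px scaler_sumr; apply: eq_bigr => k _; rewrite scalerA mulrC.
apply: combo => // k wk; apply: contraNneq wk => e.
have -> : k = j by apply: enum_val_inj; rewrite ij.
by rewrite /wn; apply/eqP/max_idPr; rewrite oppr_le0 ltW.
Qed.

(** Helly supplies at most [n] points and interpolation wants exactly [n], so the list is padded to
    the right. The path starts at -1 so that 0 may be one of the points. *)
Lemma extend_sorted (s : seq R) (n : nat) : (size s <= n)%nat -> all (>= 0) s ->
  exists pts : seq R, [/\ size pts = n, path <%O (-1) pts, all (>= 0) pts & {subset s <= pts}].
Proof.
move=> sn s0.
have [u [su pu u0 subu]] : exists u : seq R, [/\ (size u <= n)%nat, path.sorted <%O u, all (>= 0) u & {subset s <= u}].
  exists (sort <=%O (undup s)); split.
  - by rewrite size_sort; apply: leq_trans (size_undup s) sn.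
  - by rewrite sort_lt_sorted undup_uniq.
  - by rewrite all_sort; apply/allP => x; rewrite mem_undup => /(allP s0).
  - by move=> x xs; rewrite mem_sort mem_undup.
have {su pu} pu : path <%O (-1) u /\ (size u <= n)%nat.
  split => //; case: u pu u0 {subu su} => //= y u -> /andP [y0 _]; rewrite andbT.
  by apply: lt_le_trans y0; rewrite ltrN10.
have [k nk] : exists k, (k + size u)%nat = n by exists (n - size u)%nat; rewrite subnK //; case: pu.
case: pu => pu _; elim: k => [|k IH] in u u0 subu nk pu *.
  by exists u; split.
apply: (IH (rcons u (last 0 (0 :: u) + 1))).
- rewrite all_rcons u0 andbT addr_ge0 //=.
  by case/lastP: {nk pu subu} u u0 => //= u y; rewrite last_rcons all_rcons => /andP [].
- by move=> x /subu; rewrite mem_rcons inE => ->; rewrite orbT.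
- by rewrite size_rcons -addSnnS.
- rewrite rcons_path pu /=.
  case/lastP: {nk pu subu u0} u => [|u y] /=; first by rewrite add0r (lt_trans (ltrN10 _)) ?ltr01.
  by rewrite !last_rcons ltrDl ltr01.
Qed.

End Helly.

(** * Comparison of two rates *)

Lemma derives_sum (n : nat) (f f' : 'I_n -> R -> R) : (forall i, derives (f i) (f' i)) ->
  derives (fun t => \big[Rplus/R0]_(i < n) f i t) (fun t => \big[Rplus/R0]_(i < n) f' i t).
Proof.
elim: n f f' => [|n IH] f f' df t.
  apply: (is_derive_ext (fun=> 0)) => [u|]; first by rewrite big_ord0.
  by rewrite big_ord0; auto_derive.
apply: (is_derive_ext (fun u => f ord0 u + \big[Rplus/R0]_(i < n) f (lift ord0 i) u)) => [u|].
  by rewrite big_ord_recl.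
rewrite big_ord_recl; apply: is_derive_plus; first exact: df.
by apply: (IH (fun i => f (lift ord0 i)) (fun i => f' (lift ord0 i))) => i; exact: df.
Qed.

Lemma derives_scal (c : R) (f f' : R -> R) : derives f f' ->
  derives (fun t => c * f t) (fun t => c * f' t).
Proof. by move=> df t; apply: is_derive_scal; exact: df. Qed.

Definition comb (n : nat) (c : 'I_n -> R) (phi : 'I_n -> R -> R) (t : R) : R :=
  \big[Rplus/R0]_(k < n) (c k * phi k t).

Lemma derives_comb (n : nat) (c : 'I_n -> R) (phi phi' : 'I_n -> R -> R) :
  (forall i, derives (phi i) (phi' i)) -> derives (comb c phi) (comb c phi').
Proof. by move=> h; apply: derives_sum => i; exact: derives_scal. Qed.

Lemma chain_sum (l : seq R) (n : nat) (f g : 'I_n -> R -> R) :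
  (forall i, chain l (f i) (g i)) ->
  chain l (fun t => \big[Rplus/R0]_(i < n) f i t) (fun t => \big[Rplus/R0]_(i < n) g i t).
Proof.
elim: n f g => [|n IH] f g h.
  by apply: chain_eq (expsol0 l) _ _ => t; rewrite big_ord0.
have h1 := IH (fun i => f (lift ord0 i)) (fun i => g (lift ord0 i)) (fun i => h _).
by apply: chain_eq (chain_lin 1 1 (h ord0) h1) _ _ => t; rewrite big_ord_recl !Rmult_1_l.
Qed.

Lemma expsol_comb (l : seq R) (n : nat) (c : 'I_n -> R) (phi : 'I_n -> R -> R) :
  (forall i, expsol l (phi i)) -> expsol l (comb c phi).
Proof.
move=> h; have hh i : chain l (fun t => c i * phi i t) (fun t => c i * 0).
  by apply: chain_eq (chain_lin (c i) 0 (h i) (h i)) _ _ => t; ring.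
apply: chain_eq (chain_sum hh) _ _ => // t.
by rewrite big1 // => i _; ring.
Qed.

(** Variation of constants; differentiability of [g] gives the continuity of the integrand. *)
Lemma first_order_ode (a : R) (g g' : R -> R) : derives g g' ->
  exists f, derives f (fun t => g t - a * f t).
Proof.
move=> dg; pose F t := RInt (fun s => exp (a * s) * g s) 0 t.
have cF u : continuous (fun s => exp (a * s) * g s) u.
  have h := derives_mul (derives_exp a) dg u.
  apply: ex_derive_continuous; exists (a * exp (a * u) * g u + exp (a * u) * g' u); exact: h.
have dF : derives F (fun t => exp (a * t) * g t).
  move=> t; apply: (is_derive_RInt (fun s => exp (a * s) * g s) F 0 t); last exact: cF.
  by apply: filter_forall => u; apply: RInt_correct; apply: ex_RInt_continuous => z _.
exists (fun t => exp (- a * t) * F t) => t.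
apply: is_derive_eq (derives_mul (derives_exp (- a)) dF t) _.
rewrite -Rmult_assoc -exp_plus; have -> : - a * t + a * t = 0 by ring.
by rewrite exp_0; ring.
Qed.

(** Each function of the smaller family is lifted through [D + a], and [exp (- a t)] is added at
    index [ord0]. Applying [D + a] to a vanishing combination kills the new function and leaves a
    relation in the smaller family. *)
Lemma expsol_basis (l : seq R) : exists phi : 'I_(size l) -> R -> R,
  (forall i, expsol l (phi i)) /\
  (forall c, (forall t, comb c phi t = 0) -> forall k, c k = 0).
Proof.
elim: l => [|a l [phi [hphi ind]]] /=; first by exists (fun _ _ => 0); split => [[]|c _ []].
have /fin_all_exists [psi hpsi] (k : 'I_(size l)) :
    exists f, derives f (fun t => phi k t - a * f t).
  by have [phi' d _] := expsol_deriv (hphi k); exact: first_order_ode d.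
pose chi (i : 'I_(size l).+1) := if unlift ord0 i is Some k then psi k else fun t => exp (- a * t).
pose eta (i : 'I_(size l).+1) := if unlift ord0 i is Some k then phi k else fun=> 0.
have dchi i : derives (chi i) (fun t => eta i t - a * chi i t).
  rewrite /chi /eta; case: unliftP => [k|] _; first exact: hpsi.
  by move=> t; apply: is_derive_eq (derives_exp (- a) t) _; ring.
exists chi; split.
  move=> i; exists (eta i) => //; rewrite /eta; case: unliftP => [k|] _; first exact: hphi.
  exact: expsol0.
move=> c h.
have c0 : comb c chi = fun=> 0 by exact: functional_extensionality.
have := derives_comb c dchi; rewrite c0 => d1.
have d2 : derives (fun=> 0) (fun=> 0) by move=> t; auto_derive.
have e := derives_uniq d1 d2.
have ceta t : comb c eta t = 0.
  have := congr1 (fun f => f t) e; have := h t; rewrite /comb.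
  have -> : \big[Rplus/R0]_(k < (size l).+1) (c k * (eta k t - a * chi k t)) =
     \big[Rplus/R0]_(k < (size l).+1) (c k * eta k t) +
     - a * \big[Rplus/R0]_(k < (size l).+1) (c k * chi k t).
    by rewrite big_distrr -big_split; apply: eq_bigr => k _ /=; ring.
  by move=> ->; lra.
have ctail k : c (lift ord0 k) = 0.
  apply: (ind (fun k => c (lift ord0 k))) => t; have := ceta t.
  rewrite /comb big_ord_recl {1}/eta unlift_none Rmult_0_r Rplus_0_l => <-.
  by apply: eq_bigr => j _; rewrite /eta liftK.
move=> k; case: (unliftP ord0 k) => [j ->|->]; first exact: ctail.
have := h 0; rewrite /comb big_ord_recl big1 => [|j _]; last by rewrite ctail; ring.
by rewrite /chi unlift_none Rmult_0_r exp_0; lra.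
Qed.

Lemma zer_path (f : R -> R) (pts : seq R) : forall lo, path <%O lo pts ->
  (forall x, x \in pts -> f x = 0) -> zer f lo (size pts).
Proof.
elim: pts => [|y pts IH] lo //= /andP [/RltP h1 h2] h; exists y => //; split.
  by apply: h; rewrite inE eqxx.
by apply: IH => // x hx; apply: h; rewrite inE hx orbT.
Qed.

Lemma alt_path (f : R -> R) (pts : seq R) : forall s lo, path <%O lo pts ->
  (forall i, (i < size pts)%nat -> 0 < s * (-1) ^ i * f (nth 0 pts i)) ->
  alt f s lo (size pts).
Proof.
elim: pts => [|y pts IH] s lo //= /andP [/RltP h1 h2] h; exists y => //; split.
  by have := h 0%nat erefl; rewrite /=; lra.
by apply: IH => // i hi; have := h i.+1 hi; rewrite /=; lra.
Qed.

Definition collocation (n : nat) (phi : 'I_n -> R -> R) (pts : seq R) : 'M[R]_n :=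
  \matrix_(k, i) phi k (nth 0 pts i).

Lemma comb_collocation (n : nat) (phi : 'I_n -> R -> R) (pts : seq R) (c : 'rV[R]_n) (i : 'I_n) :
  comb (c ord0) phi (nth 0 pts i) = mulmx c (collocation phi pts) ord0 i.
Proof. by rewrite mxE; apply: eq_bigr => k _; rewrite mxE. Qed.

(** A left kernel vector is a combination with [size l] zeros, hence 0 by the Chebyshev property. *)
Lemma collocation_unit (l : seq R) (phi : 'I_(size l) -> R -> R) (lo : R) (pts : seq R) :
  (forall i, expsol l (phi i)) ->
  (forall c, (forall t, comb c phi t = 0) -> forall k, c k = 0) ->
  size pts = size l -> path <%O lo pts -> collocation phi pts \in unitmx.
Proof.
move=> hphi ind sz ppts.
rewrite unitmxE GRing.unitfE; apply/negP => /det0P [v v0 vM].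
case/negP: v0; apply/eqP/matrixP => i k; rewrite [i]ord1 !mxE; apply: ind.
suff -> : comb (v ord0) phi = fun=> 0 by [].
apply: (@zer_expsol l _ lo); first exact: expsol_comb.
have hz := @zer_path (comb (v ord0) phi) pts lo ppts.
rewrite sz in hz; apply: hz => x /(nthP 0) [j hj <-].
rewrite sz in hj; have := comb_collocation phi pts v (Ordinal hj); rewrite /= => ->.
by rewrite vM mxE.
Qed.

Lemma expsol_vanishing (l : seq R) (delta : R) (f : R -> R) : 0 < delta ->
  (forall a, a \in l -> delta < a) -> expsol l f -> vanishing f.
Proof. by move=> d0 hl hf; have [C hC] := expsol_decay hl hf; exact: decay_vanishing d0 hC. Qed.

Lemma vanishing_lin (c1 c2 : R) (f g : R -> R) : vanishing f -> vanishing g ->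
  vanishing (fun t => c1 * f t + c2 * g t).
Proof.
move=> hf hg e e0; pose K := Rabs c1 + Rabs c2 + 1.
have [p1 p2] := (Rabs_pos c1, Rabs_pos c2).
have K0 : 0 < K by rewrite /K; lra.
have eK : 0 < e / K by exact: Rdiv_lt_0_compat.
have [T1 h1] := hf _ eK; have [T2 h2] := hg _ eK.
exists (Rmax T1 T2) => t ht.
have k1 := h1 t (Rle_trans _ _ _ (Rmax_l _ _) ht).
have k2 := h2 t (Rle_trans _ _ _ (Rmax_r _ _) ht).
apply: Rle_lt_trans (Rabs_triang _ _) _; rewrite !Rabs_mult.
have m1 := Rmult_le_compat_l _ _ _ p1 (Rlt_le _ _ k1).
have m2 := Rmult_le_compat_l _ _ _ p2 (Rlt_le _ _ k2).
have e2 : e = (Rabs c1 + Rabs c2 + 1) * (e / K) by rewrite -/K; field; lra.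
lra.
Qed.

Section Comparison.
Variables (l : seq R) (a rho delta : R).
Hypotheses (delta0 : 0 < delta) (hl : forall b, b \in l -> delta < b) (ha : delta < a) (aR : a < rho).

Let hla b : b \in rcons l a -> delta < b.
Proof. by rewrite mem_rcons inE => /orP [/eqP ->|/hl]. Qed.

Let hlR b : b \in rcons l rho -> delta < b.
Proof. by rewrite mem_rcons inE => /orP [/eqP ->|/hl //]; lra. Qed.

(* Otherwise [h = Q - c q] has [h''(0) < 0], and [h''] alternates at [size l + 2] points.
   Applying the [size l + 1] operators of [rcons l a] kills the part coming from [q] and
   turns that of [Q] into a multiple of [exp (- rho t)], whose sign is that of
   [(a - rho) C], [C] being the coefficient that the operators of [l] leave of [Q].
   The alternations of [Q] give [C] the wrong sign. *)
Lemma alternation_compare (Q Q1 Q2 q q1 q2 : R -> R) (c lo t0 : R) :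
  expsol (rcons l rho) Q -> derives Q Q1 -> derives Q1 Q2 ->
  expsol (rcons l a) q -> derives q q1 -> derives q1 q2 ->
  alt Q 1 lo (size l).+1 -> 0 <= t0 -> 0 < Q t0 - c * q t0 ->
  alt (fun t => Q t - c * q t) (-1) t0 (size l) ->
  c * q2 0 <= Q2 0.
Proof.
move=> hQ dQ dQ1 hq dq dq1 altQ t00 h0 alth.
have hE : (fun t => Q t - c * q t) = (fun t => 1 * Q t + (- c) * q t).
  by apply: functional_extensionality => t; ring.
apply: Rnot_lt_le => lt2.
pose h := fun t => 1 * Q t + (- c) * q t.
pose h1 := fun t => 1 * Q1 t + (- c) * q1 t.
pose h2 := fun t => 1 * Q2 t + (- c) * q2 t.
have dh : derives h h1 by exact: derives_lin.
have dh1 : derives h1 h2 by exact: derives_lin.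
have hQ1 : expsol (rcons l rho) Q1 by have [f df hf] := expsol_deriv hQ; rewrite (derives_uniq dQ df).
have hq1 : expsol (rcons l a) q1 by have [f df hf] := expsol_deriv hq; rewrite (derives_uniq dq df).
have hq2 : expsol (rcons l a) q2 by have [f df hf] := expsol_deriv hq1; rewrite (derives_uniq dq1 df).
have vh : vanishing h.
  by apply: vanishing_lin; [exact: expsol_vanishing delta0 hlR _|exact: expsol_vanishing delta0 hla _].
have vh1 : vanishing h1.
  by apply: vanishing_lin; [exact: expsol_vanishing delta0 hlR _|exact: expsol_vanishing delta0 hla _].
(* Vanishing at infinity makes both differentiations free: from [t0] on, [h] has [size l + 1]
   alternations, and so do [h1] and [h2]. *)
have alt1 : alt h1 (-1) t0 (size l).+1.
  by apply: (alt_deriv_vanishing dh vh (s := 1)); [rewrite /h; lra | rewrite -/(Ropp 1) /h -hE].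
case: alt1 => y1 hy1 [s1 alt1].
have alt2 : alt h2 1 y1 (size l).+1.
  have := alt_deriv_vanishing dh1 vh1 s1; rewrite Ropp_involutive; apply.
  by move: alt1; rewrite Ropp_involutive.
have [C hC] := expsol_rcons hQ.
pose E t := exp (- rho * t).
have dCE K : derives (fun t => K * E t) (fun t => - rho * K * E t).
  by move=> t; apply: is_derive_eq (derives_scal K (derives_exp (- rho)) t) _; rewrite /E; ring.
have [f1 df1 hf1] := chain_deriv hC (dCE C).
have [f2 df2 hf2] := chain_deriv hf1 (dCE _).
rewrite -(derives_uniq dQ df1) in df2; rewrite -(derives_uniq dQ1 df2) in hf2.
(* The operators of [l] leave [rho^2 C exp (- rho t)] of [Q''], and [D + a] multiplies this by
   [a - rho]. *)
pose K := (a - rho) * (rho * rho * C).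
have hfin : chain (rcons l a) Q2 (fun t => K * E t).
  rewrite -cats1; apply: chain_cat hf2 _; exists (fun t => K * E t) => // t.
  by apply: is_derive_eq (dCE _ t) _; rewrite /K; ring.
have hh2 : chain (rcons l a) h2 (fun t => K * E t).
  by apply: chain_eq (chain_lin 1 (- c) hfin hq2) _ _ => t //; ring.
have [z1 _ [sK _]] : alt (fun t => K * E t) (iter (size l) Ropp 1) (-1) 1.
  have := @alt_chain (rcons l a) 1 h2 (fun t => K * E t) (-1) (-1) hh2.
  rewrite size_rcons iterSr Ropp_involutive; apply.
  (* The assumed [h2 0 < 0] is the extra alternation, in front of those beyond [y1 > 0]. *)
  rewrite addn1; exists 0; first by lra.
  split; first by rewrite /h2; lra.
  by rewrite Ropp_involutive; apply: alt_mono alt2; lra.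
have [z2 _ [sC _]] : alt (fun t => C * E t) (iter (size l) Ropp 1) lo 1.
  by apply: (alt_chain hC); rewrite addn1.
have Ez1 : 0 < E z1 by exact: exp_pos.
have Ez2 : 0 < E z2 by exact: exp_pos.
move: sK sC; set s := iter _ _ _ => sK sC.
have sC' : 0 < s * C by apply: (Rmult_lt_reg_r (E z2)) => //; lra.
have : 0 < (rho - a) * (rho * rho) * (s * C) * E z1.
  by apply: Rmult_lt_0_compat => //; apply: Rmult_lt_0_compat => //; apply: Rmult_lt_0_compat; [|apply: Rmult_lt_0_compat]; lra.
have -> : (rho - a) * (rho * rho) * (s * C) * E z1 = - (s * (K * E z1)) by rewrite /K; ring.
lra.
Qed.

Lemma interpolation_compare (Q Q1 Q2 q q1 q2 : R -> R) (pts : seq R) :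
  expsol (rcons l rho) Q -> derives Q Q1 -> derives Q1 Q2 ->
  expsol (rcons l a) q -> derives q q1 -> derives q1 q2 ->
  size pts = (size l).+1 -> path <%O (-1) pts -> (forall x, x \in pts -> 0 <= x) ->
  (forall i, (i < size pts)%nat -> Q (nth 0 pts i) = (-1) ^ i) ->
  (forall t, 0 <= t -> Rabs (q t) <= 1) ->
  q2 0 <= Q2 0.
Proof.
move=> hQ dQ dQ1 hq dq dq1 sz ppts pos hv hb.
have sgn i : (-1) ^ i * (-1) ^ i = 1.
  by rewrite -Rpow_mult_distr; have -> : -1 * -1 = 1 by [ring]; rewrite pow1.
(* At the interpolation points [|c q| < 1 = |Q|], so [Q - c q] has strictly the sign of [Q] there.
   The case [c = 1] follows in the limit. *)
have key c : 0 < c < 1 -> c * q2 0 <= Q2 0.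
  move=> hc.
  have hsgn i : (i < size pts)%nat ->
      0 < (-1) ^ i * (Q (nth 0 pts i) - c * q (nth 0 pts i)).
    move=> hi; rewrite hv // Rmult_minus_distr_l sgn.
    have := hb _ (pos _ (mem_nth 0 hi)); set x := q _ => hx.
    have : Rabs ((-1) ^ i * (c * x)) <= c.
      rewrite !Rabs_mult (Rabs_pos_eq c); last by lra.
      rewrite -RPow_abs Rabs_Ropp Rabs_R1 pow1 Rmult_1_l.
      by have := Rmult_le_compat_l c _ _ (Rlt_le _ _ (proj1 hc)) hx; lra.
    by have := Rle_abs ((-1) ^ i * (c * x)); lra.
  case: pts sz ppts pos hv hsgn => [//|t0 pts] [sz] ppts pos hv hsgn.
  apply: (alternation_compare (lo := -1) (t0 := t0) hQ dQ dQ1 hq dq dq1).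
  - rewrite -sz; apply: (alt_path ppts) => i hi.
    by rewrite hv // Rmult_1_l sgn; lra.
  - by apply: pos; rewrite inE eqxx.
  - by have := hsgn 0%nat erefl; rewrite /= Rmult_1_l.
  - rewrite -sz; case/andP: ppts => _ ppts; apply: alt_path => // i hi.
    by have := hsgn i.+1 hi; rewrite /= => h; lra.
apply: Rnot_lt_le => lt.
(* Chosen so that [e |q2 0| < D]: then [c = 1 - e] already contradicts [key]. *)
pose D := q2 0 - Q2 0; pose e := D / (2 * (Rabs (q2 0) + D)).
have D0 : 0 < D by rewrite /D; lra.
have q0 := Rabs_pos (q2 0).
have e0 : 0 < e by apply: Rdiv_lt_0_compat => //; lra.
have eE : e * (Rabs (q2 0) + D) = D / 2 by rewrite /e; field; lra.
have eD : e * Rabs (q2 0) + e * D = D / 2 by lra.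
have p1 := Rmult_le_pos _ _ (Rlt_le _ _ e0) q0.
have e1 : e < 1 by apply: (Rmult_lt_reg_r D) => //; lra.
have := key (1 - e) ltac:(lra).
have := Rmult_le_compat_l _ _ _ (Rlt_le _ _ e0) (Rle_abs (q2 0)).
have := Rmult_lt_0_compat _ _ e0 D0.
rewrite /D in eD *; lra.
Qed.

End Comparison.

(** * Passing from finite grids to the half-line *)

Lemma Rsum_le (I : finType) (F G : I -> R) : (forall i, F i <= G i) ->
  \big[Rplus/R0]_i F i <= \big[Rplus/R0]_i G i.
Proof. by move=> h; apply: (big_ind2 Rle) => //; [lra | move=> *; lra]. Qed.

Lemma Rabs_sum_le (I : finType) (F : I -> R) :
  Rabs (\big[Rplus/R0]_i F i) <= \big[Rplus/R0]_i Rabs (F i).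
Proof.
apply: (big_ind2 (fun x y => Rabs x <= y)) => [|x1 x2 y1 y2 h1 h2|i _]; last by lra.
  by rewrite Rabs_R0; lra.
by have := Rabs_triang x1 y1; lra.
Qed.

Lemma Rsum_ge0 (I : finType) (F : I -> R) : (forall i, 0 <= F i) ->
  0 <= \big[Rplus/R0]_i F i.
Proof. by move=> h; apply: (big_ind (Rle 0)) => //; [lra | move=> *; lra]. Qed.

Lemma comb_bound (n : nat) (c K B : 'I_n -> R) (phi : 'I_n -> R -> R) (t e : R) :
  (forall k, Rabs (c k) <= K k) -> (forall k, Rabs (phi k t) <= B k * e) ->
  Rabs (comb c phi t) <= \big[Rplus/R0]_(k < n) (K k * B k) * e.
Proof.
move=> hc hphi; apply: Rle_trans (Rabs_sum_le _) _.
rewrite big_distrl; apply: Rsum_le => k /=; rewrite Rabs_mult Rmult_assoc.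
by apply: Rmult_le_compat => //; exact: Rabs_pos.
Qed.

Definition halfspace (n : nat) (a : 'I_n -> R) (b : R) (c : 'rV[R]_n) : Prop :=
  \big[Rplus/R0]_(k < n) (c ord0 k * a k) <= b.

Lemma halfspace_convex (n : nat) (a : 'I_n -> R) (b : R) :
  convex_pred (halfspace a b : 'rV[R]_n -> Prop).
Proof.
move=> m w x w0 w1 hx; rewrite /halfspace.
have -> : \big[Rplus/R0]_(k < n)
    (fun_of_matrix (\big[GRing.add/GRing.zero]_j GRing.scale (w j) (x j)) ord0 k * a k) =
  \big[Rplus/R0]_(j < m) (w j * \big[Rplus/R0]_(k < n) (x j ord0 k * a k)).
  under [RHS]eq_bigr => j _ do rewrite big_distrr.
  rewrite [RHS]exchange_big; apply: eq_bigr => k _.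
  rewrite summxE [LHS]big_distrl; apply: eq_bigr => j _.
  by rewrite mxE /= -Rmult_assoc.
have -> : b = \big[Rplus/R0]_(j < m) (w j * b).
  by rewrite -[LHS]Rmult_1_l -big_distrl; congr (_ * _); symmetry.
apply: Rsum_le => j; case: (Req_dec (w j) 0) => [->|wj]; first by lra.
by apply: Rmult_le_compat_l; [exact/RleP | apply: hx; apply/eqP].
Qed.

(** One-sided and at 0 only: translation in time, rescaling and a change of sign turn it into a
    bound on [|q''|] everywhere ([second_bound_scaled]). *)
Definition second_bound (l : seq R) (M : R) : Prop :=
  forall q q1 q2 : R -> R, expsol l q -> derives q q1 -> derives q1 q2 ->
    (forall t, 0 <= t -> Rabs (q t) <= 1) -> q2 0 <= M.

Lemma second_bound_ge0 (l : seq R) (M : R) : second_bound l M -> 0 <= M.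
Proof.
have d0 : derives (fun=> 0) (fun=> 0) by move=> t; auto_derive.
by move=> h; apply: (h _ _ _ (expsol0 l) d0 d0) => t _; rewrite Rabs_R0; lra.
Qed.

Section Grid.
Variables (l : seq R) (a rho delta : R).
Hypotheses (delta0 : 0 < delta) (hl : forall b, b \in l -> delta < b) (ha : delta < a) (aR : a < rho).
Variables (phi phi1 phi2 : 'I_(size (rcons l rho)) -> R -> R).
Hypotheses (hphi : forall i, expsol (rcons l rho) (phi i))
  (ind : forall c, (forall t, comb c phi t = 0) -> forall k, c k = 0)
  (dphi : forall i, derives (phi i) (phi1 i)) (dphi1 : forall i, derives (phi1 i) (phi2 i)).
Local Notation n := (size (rcons l rho)).

(* Helly with one constraint [q2 0 <= Q''(0)] (index [None]) and two constraints
   [+-Q(p) <= 1] per grid point: [n + 1] of them either omit the first, and [Q = 0] works,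
   or involve at most [n] points, and the alternating interpolant works. *)
Lemma grid_feasible (q q1 q2 : R -> R) (ps : seq R) :
  expsol (rcons l a) q -> derives q q1 -> derives q1 q2 ->
  (forall t, 0 <= t -> Rabs (q t) <= 1) -> (forall p, p \in ps -> 0 <= p) ->
  exists c : 'rV[R]_n, q2 0 <= comb (c ord0) phi2 0 /\
    forall p, p \in ps -> Rabs (comb (c ord0) phi p) <= 1.
Proof.
move=> hq dq dq1 qb ps0.
pose sg (b : bool) := if b then -1 else 1.
pose coef (o : option (seq_sub ps * bool)) (k : 'I_n) :=
  if o is Some (p, b) then sg b * phi k (ssval p) else - phi2 k 0.
pose rhs (o : option (seq_sub ps * bool)) := if o is Some _ then 1 else - q2 0.
have sumS p b (c : 'rV[R]_n) : \big[Rplus/R0]_(k < n) (c ord0 k * coef (Some (p, b)) k) =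
    sg b * comb (c ord0) phi (ssval p).
  by rewrite /comb big_distrr; apply: eq_bigr => k _ /=; ring.
have sumN (c : 'rV[R]_n) : \big[Rplus/R0]_(k < n) (c ord0 k * coef None k) =
    -1 * comb (c ord0) phi2 0.
  by rewrite /comb big_distrr; apply: eq_bigr => k _ /=; ring.
have [c hc] : exists c, forall o, halfspace (coef o) (rhs o) c.
  apply: helly => [o|B cB]; first exact: halfspace_convex.
  have [NB|NB] := boolP (None \in B); last first.
    exists GRing.zero => -[pb|] iB; last by rewrite iB in NB.
    by rewrite /halfspace big1 => [|k _]; [rewrite /=; lra | rewrite mxE; exact: Rmult_0_l].
  pose s := pmap (omap (fun pb : seq_sub ps * bool => ssval pb.1)) (enum (B :\ None)).
  have sn : (size s <= n)%nat.
    rewrite size_pmap; apply: leq_trans (count_size _ _) _.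
    by rewrite -cardE -ltnS; apply: leq_trans cB; rewrite [in X in (_ <= X)%nat](cardsD1 None) NB.
  have s0 : all (fun x : R => Num.Def.ler 0 x)%R s.
    apply/allP => x; rewrite mem_pmap => /mapP [[[p b]|] // _ [->]].
    by apply/RleP; apply: ps0; exact: ssvalP.
  have [pts [szp ppts pts0 sub]] := extend_sorted sn s0.
  have uM := collocation_unit hphi ind szp ppts.
  pose c : 'rV[R]_n := mulmx (\row_(i < n) (-1) ^ i) (invmx (collocation phi pts)).
  have cE i : (i < n)%nat -> comb (c ord0) phi (nth 0 pts i) = (-1) ^ i.
    move=> hi; have := comb_collocation phi pts c (Ordinal hi); rewrite /= => ->.
    by rewrite mulmxKV // mxE.
  exists c => -[[p b]|] iB; rewrite /halfspace.
    rewrite sumS /=.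
    have : ssval p \in pts.
      apply: sub; rewrite mem_pmap; apply/mapP; exists (Some (p, b)) => //.
      by rewrite mem_enum !inE.
    move=> /(nthP 0) [i]; rewrite szp => hi <-; rewrite cE //.
    apply: Rle_trans (Rle_abs _) _.
    rewrite Rabs_mult -RPow_abs Rabs_Ropp Rabs_R1 pow1 /sg.
    by case: b {iB}; rewrite ?Rabs_Ropp Rabs_R1; lra.
  rewrite sumN /=.
  have h : q2 0 <= comb (c ord0) phi2 0; last by lra.
  apply: (interpolation_compare delta0 hl ha aR (pts := pts)
    (expsol_comb (c ord0) hphi) (derives_comb _ dphi) (derives_comb _ dphi1) hq dq dq1) => //.
  - by rewrite szp size_rcons.
  - by move=> x hx; apply/RleP; exact: (allP pts0).
  - by move=> i; rewrite szp; exact: cE.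
exists c; split; first by have := hc None; rewrite /halfspace sumN /=; lra.
move=> p pin; have h1 := hc (Some (SeqSub pin, false)); have h2 := hc (Some (SeqSub pin, true)).
by move: h1 h2; rewrite /halfspace !sumS /= => h1 h2; apply: Rabs_le; lra.
Qed.

Let ips := [seq INR i | i <- seq.iota 0 n].

Lemma path_INR (m k : nat) (x : R) : x < INR k -> path <%O x [seq INR i | i <- seq.iota k m].
Proof.
elim: m k x => [|m IH] k x h //=; apply/andP; split; first exact/RltP.
by apply: IH; apply: lt_INR; lia.
Qed.

(** The values at the [n] points [ips] determine the coefficients through the inverse collocation
    matrix. As [ips] is fixed, the bound survives any refinement of the grid. *)
Lemma coef_bound : exists K : 'I_n -> R, forall c : 'rV[R]_n,
  (forall p, p \in ips -> Rabs (comb (c ord0) phi p) <= 1) -> forall k, Rabs (c ord0 k) <= K k.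
Proof.
have szi : size ips = n by rewrite size_map size_iota.
have pi : path <%O (-1) ips by apply: path_INR => /=; lra.
have uM := collocation_unit hphi ind szi pi.
exists (fun k => \big[Rplus/R0]_(i < n) Rabs (invmx (collocation phi ips) i k)) => c hc k.
rewrite -[c](mulmxK uM) mxE; apply: Rle_trans (Rabs_sum_le _) _; apply: Rsum_le => i.
rewrite -comb_collocation; have := hc (nth 0 ips i); rewrite mem_nth ?szi // => /(_ erefl) h.
rewrite Rabs_mult -[X in _ <= X]Rmult_1_l.
by apply: Rmult_le_compat_r => //; exact: Rabs_pos.
Qed.

(** The grid consists of [ips] and a mesh of width [h] on [[0, T]]. Beyond [T] the uniform decay
    gives [|Q| < 1]; between mesh points the uniform bound [H'] on [|Q'|] adds at most
    [H' h = eta]. *)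
Lemma near_feasible (q q1 q2 : R -> R) (eta : R) :
  expsol (rcons l a) q -> derives q q1 -> derives q1 q2 ->
  (forall t, 0 <= t -> Rabs (q t) <= 1) -> 0 < eta ->
  exists c : 'I_n -> R, q2 0 <= comb c phi2 0 /\
    forall t, 0 <= t -> Rabs (comb c phi t) <= 1 + eta.
Proof.
move=> hq dq dq1 qb eta0.
have hlR b : b \in rcons l rho -> delta < b.
  by rewrite mem_rcons inE => /orP [/eqP ->|/hl //]; lra.
have [K hK] := coef_bound.
have /fin_all_exists [C hC] (k : 'I_n) : exists C, forall t, 0 <= t -> Rabs (phi k t) <= C * exp (- delta * t).
  exact: expsol_decay hlR _ (hphi k).
have /fin_all_exists [D hD] (k : 'I_n) : exists D, forall t, 0 <= t -> Rabs (phi1 k t) <= D * exp (- delta * t).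
  apply: expsol_decay hlR _ _; have [f df hf] := expsol_deriv (hphi k).
  by rewrite (derives_uniq (dphi k) df).
pose G := \big[Rplus/R0]_(k < n) (K k * C k).
pose H := \big[Rplus/R0]_(k < n) (K k * D k).
have [T hT] : exists T, forall t, T <= t -> Rabs (G * exp (- delta * t)) < 1.
  apply: (@decay_vanishing (fun t => G * exp (- delta * t)) (Rabs G) delta) => //; last by lra.
  by move=> t _; rewrite Rabs_mult (Rabs_pos_eq (exp _)); [lra | exact: Rlt_le (exp_pos _)].
pose H' := Rabs H + 1; have H0 : 0 < H' by have := Rabs_pos H; rewrite /H'; lra.
pose h := eta / H'; have h0 : 0 < h by exact: Rdiv_lt_0_compat.
have [N hN] : exists N, T / h < INR N.
  have [N [_ hN]] := nfloor_ex (Rabs (T / h)) (Rabs_pos _).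
  by exists N.+1; rewrite S_INR; have := Rle_abs (T / h); lra.
pose ps := ips ++ [seq INR i * h | i <- seq.iota 0 N].
have ps0 p : p \in ps -> 0 <= p.
  rewrite mem_cat => /orP [] /mapP [i _ ->]; first exact: pos_INR.
  by apply: Rmult_le_pos; [exact: pos_INR | lra].
have [c [hc1 hc2]] := grid_feasible hq dq dq1 qb ps0.
have cK k : Rabs (c ord0 k) <= K k.
  by apply: hK => p hp; apply: hc2; rewrite mem_cat hp.
exists (c ord0); split => // t t0.
have b1 : Rabs (comb (c ord0) phi t) <= G * exp (- delta * t).
  by apply: comb_bound => // k; exact: hC.
case: (Rle_lt_dec T t) => tT.
  by have := hT t tT; have := Rle_abs (G * exp (- delta * t)); lra.
have [j [hj1 hj2]] := nfloor_ex (t / h) (Rdiv_le_0_compat _ _ t0 h0).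
have hj3 : INR j * h <= t.
  by have := Rmult_le_compat_r _ _ _ (Rlt_le _ _ h0) hj1; have -> : t / h * h = t by [field; lra].
have hj4 : t < INR j * h + h.
  have := Rmult_lt_compat_r _ _ _ h0 hj2; have -> : t / h * h = t by [field; lra].
  by lra.
have jN : (j < N)%nat.
  apply/ltP; apply: INR_lt; apply: Rle_lt_trans hj1 _; apply: Rlt_trans hN.
  by apply: Rmult_lt_compat_r => //; exact: Rinv_0_lt_compat.
have := hc2 (INR j * h); rewrite mem_cat map_f ?orbT; last by rewrite mem_iota.
move=> /(_ erefl) b2.
case: (Req_dec t (INR j * h)) => [->|tne]; first by lra.
have [|s hs e] := derives_mvt (derives_comb (c ord0) dphi) (a := INR j * h) (b := t); first by lra.
have js0 : 0 <= INR j * h by apply: Rmult_le_pos; [exact: pos_INR | lra].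
have b3 : Rabs (comb (c ord0) phi1 s) <= H * exp (- delta * s).
  by apply: comb_bound => // k; apply: hD; lra.
have b4 : Rabs (comb (c ord0) phi1 s) <= H'.
  apply: Rle_trans b3 _; apply: (@Rle_trans _ (Rabs H * 1)); last by rewrite /H'; lra.
  apply: (@Rle_trans _ (Rabs H * exp (- delta * s))).
    by apply: Rmult_le_compat_r; [exact: Rlt_le (exp_pos _) | exact: Rle_abs].
  apply: Rmult_le_compat_l; first exact: Rabs_pos.
  have := exp_ineq1_le (delta * s) => e1.
  have e2 : exp (delta * s) * exp (- delta * s) = 1.
    rewrite -exp_plus; have -> : delta * s + - delta * s = 0 by ring.
    exact: exp_0.
  have ds : 0 <= delta * s by apply: Rmult_le_pos; lra.
  have e3 := exp_pos (- delta * s).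
  have : 1 * exp (- delta * s) <= exp (delta * s) * exp (- delta * s) by apply: Rmult_le_compat_r; lra.
  by lra.
have -> : comb (c ord0) phi t = comb (c ord0) phi (INR j * h) + comb (c ord0) phi1 s * (t - INR j * h).
  by lra.
apply: Rle_trans (Rabs_triang _ _) _; apply: Rplus_le_compat => //.
rewrite Rabs_mult (Rabs_pos_eq (t - _)); last by lra.
apply: (@Rle_trans _ (H' * h)); last by rewrite /h; have -> : H' * (eta / H') = eta by [field; lra]; lra.
by apply: Rmult_le_compat => //; [exact: Rabs_pos | lra | lra].
Qed.

End Grid.

Lemma second_bound_rcons (l : seq R) (a rho delta M : R) : 0 < delta ->
  (forall b, b \in l -> delta < b) -> delta < a -> a < rho ->
  second_bound (rcons l rho) M -> second_bound (rcons l a) M.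
Proof.
move=> delta0 hl ha aR bM q q1 q2 hq dq dq1 qb.
have M0 := second_bound_ge0 bM.
have [phi [hphi ind]] := expsol_basis (rcons l rho).
have /fin_all_exists [phi1 h1] k : exists f, derives (phi k) f /\ expsol (rcons l rho) f.
  by have [f df hf] := expsol_deriv (hphi k); exists f.
have /fin_all_exists [phi2 h2] k : exists f, derives (phi1 k) f.
  by have [f df hf] := expsol_deriv (proj2 (h1 k)); exists f.
(* Division by [1 + eta] makes the near-feasible function admissible for [bM]. *)
have step eta : 0 < eta -> q2 0 <= M * (1 + eta).
  move=> eta0.
  have [c [c1 c2]] := near_feasible delta0 hl ha aR hphi ind (fun i => proj1 (h1 i)) h2 hq dq dq1 qb eta0.
  have i0 : 0 < / (1 + eta) by apply: Rinv_0_lt_compat; lra.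
  have hQ : expsol (rcons l rho) (fun t => / (1 + eta) * comb c phi t).
    have hc := expsol_comb c hphi.
    by apply: chain_eq (expsol_lin (/ (1 + eta)) 0 hc hc) _ _ => t //; ring.
  have := bM _ _ _ hQ (derives_scal _ (derives_comb c (fun i => proj1 (h1 i))))
     (derives_scal _ (derives_comb c h2)) => h.
  have {}h : / (1 + eta) * comb c phi2 0 <= M.
    apply: h => t t0; rewrite Rabs_mult Rabs_pos_eq; last by lra.
    have := Rmult_le_compat_l _ _ _ (Rlt_le _ _ i0) (c2 t t0).
    by rewrite Rinv_l; lra.
  have := Rmult_le_compat_r (1 + eta) _ _ ltac:(lra) h.
  by rewrite Rmult_comm -Rmult_assoc Rinv_r; lra.
apply: Rnot_lt_le => lt.
have e0 : 0 < (q2 0 - M) / (2 * (M + 1)) by apply: Rdiv_lt_0_compat; lra.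
have := step _ e0; set e := _ / _ in e0 *.
have : e * (M + 1) = (q2 0 - M) / 2 by rewrite /e; field; lra.
lra.
Qed.

(* The last rate is replaced by [rho] and rotated to the front, so that the next one to
   be replaced is again last. *)
Lemma second_bound_all (l : seq R) (rho delta M : R) : 0 < delta ->
  (forall b, b \in l -> delta < b <= rho) ->
  second_bound (nseq (size l) rho) M -> second_bound l M.
Proof.
move=> delta0.
suff H k : (forall b, b \in l -> delta < b <= rho) -> delta < rho ->
    second_bound (nseq (k + size l) rho) M -> second_bound (nseq k rho ++ l) M.
  move=> hl; case: (l) (hl) H => [//|b l'] h H hM; apply: (H 0%nat) => //.
  by have := h b; rewrite inE eqxx => /(_ erefl); lra.
elim/last_ind: l k => [|l a IH] k hl dR hM.
  by rewrite cats0; rewrite addn0 in hM.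
rewrite -rcons_cat.
have hb b : b \in nseq k rho ++ l -> delta < b.
  rewrite mem_cat => /orP [|bl]; first by rewrite mem_nseq => /andP [_ /eqP ->].
  by have := hl b; rewrite mem_rcons inE bl orbT => /(_ erefl); lra.
have [ad aR] : delta < a <= rho by apply: hl; rewrite mem_rcons inE eqxx.
have bR : second_bound (rcons (nseq k rho ++ l) rho) M.
  move=> q q1 q2 /expsol_rot hq.
  have := IH k.+1 => /=; apply => //; last by move: hM; rewrite size_rcons addnS.
  by move=> b bl; apply: hl; rewrite mem_rcons inE bl orbT.
case: (Req_dec a rho) => [->//|ne].
by apply: second_bound_rcons hb ad _ bR => //; lra.
Qed.

(** * The constant [M2] *)

Lemma derives_scale (k : R) (f f' : R -> R) : derives f f' ->
  derives (fun t => f (k * t)) (fun t => k * f' (k * t)).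
Proof.
move=> df t.
have := is_derive_comp f (fun t => k * t) t _ k (df (k * t)); apply.
by auto_derive => //; ring.
Qed.

Lemma expsol_nseq (d : nat) (rho : R) : forall q : R -> R, expsol (nseq d rho) q ->
  exists c : 'I_d -> R, forall t, q t = exp (- rho * t) * \big[Rplus/R0]_(i < d) (c i * t ^ i).
Proof.
elim: d => [|d IH] q /=.
  by move=> ->; exists (fun=> 0) => t; rewrite big_ord0; ring.
move=> [q1 dq /IH [c hc]].
pose P t := \big[Rplus/R0]_(i < d) (c i * / INR i.+1 * t ^ i.+1).
have dP : derives P (fun t => \big[Rplus/R0]_(i < d) (c i * t ^ i)).
  apply: derives_sum => i t; apply: is_derive_eq (is_derive_scal _ t (c i * / INR i.+1) _ (is_derive_pow _ i.+1 t 1 (is_derive_id t))) _.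
  rewrite [Nat.pred _]/=; have := not_0_INR i.+1 ltac:(lia) => h.
  by rewrite Rmult_1_r Rmult_assoc -(Rmult_assoc (/ _)) Rinv_l // Rmult_1_l.
have dF : derives (fun t => 1 * (exp (rho * t) * q t) + -1 * P t) (fun=> 0).
  move=> t; apply: is_derive_eq (derives_lin 1 (-1) (derives_mul (derives_exp rho) dq) dP t) _.
  have e : exp (rho * t) * q1 t = \big[Rplus/R0]_(i < d) (c i * t ^ i).
    rewrite hc -Rmult_assoc -exp_plus; have -> : rho * t + - rho * t = 0 by ring.
    by rewrite exp_0 Rmult_1_l.
  by rewrite -e; ring.
exists (fun i => if unlift ord0 i is Some j then c j * / INR j.+1 else q 0) => t.
rewrite big_ord_recl unlift_none Rmult_1_r.
have -> : \big[Rplus/R0]_(i < d) ((if unlift ord0 (lift ord0 i) is Some j then c j * / INR j.+1 else q 0)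
     * t ^ (lift ord0 i)) = P t.
  by apply: eq_bigr => i _; rewrite liftK lift0.
have P0 : P 0 = 0 by rewrite /P big1 // => i _; rewrite /=; ring.
have := derives0_const dF t 0; rewrite Rmult_0_r exp_0 P0 => e.
have -> : q 0 + P t = exp (rho * t) * q t by lra.
rewrite -Rmult_assoc -exp_plus; have -> : - rho * t + rho * t = 0 by ring.
by rewrite exp_0 Rmult_1_l.
Qed.

(** Slowing time down by [rho] turns the rate into 1 and divides the second derivative by
    [rho^2]. *)
Lemma second_bound_nseq (d : nat) (M2 rho : R) : 0 < rho -> is_lub (M2_set d) M2 ->
  second_bound (nseq d rho) (M2 * (rho * rho)).
Proof.
move=> rho0 [ub _] q q1 q2 /expsol_nseq [c hc] dq dq1 qb.
have rn0 : rho <> 0 by lra.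
have d1 := derives_scale (/ rho) dq.
have d2 := derives_scal (/ rho) (derives_scale (/ rho) dq1).
suff : Rabs (/ rho * (/ rho * q2 (/ rho * 0))) <= M2.
  rewrite Rmult_0_r => h; have h1 := Rle_trans _ _ _ (Rle_abs _) h.
  have rr : 0 < rho * rho by exact: Rmult_lt_0_compat.
  have := Rmult_le_compat_r _ _ _ (Rlt_le _ _ rr) h1.
  by have -> : / rho * (/ rho * q2 0) * (rho * rho) = q2 0 by [field].
apply: ub; exists (fun i => c i * (/ rho) ^ i).
have -> : (fun t => exp (- t) * \big[Rplus/R0]_(i < d) (c i * (/ rho) ^ i * t ^ i)) = fun t => q (/ rho * t).
  apply: functional_extensionality => t; rewrite hc; congr (exp _ * _); first by field.
  by apply: eq_bigr => i _; rewrite Rpow_mult_distr Rmult_assoc.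
split=> [t t0|].
  by apply: qb; apply: Rmult_le_pos => //; apply: Rlt_le; exact: Rinv_0_lt_compat.
exists 0, (fun t => / rho * q1 (/ rho * t)), (/ rho * (/ rho * q2 (/ rho * 0))).
split; first by lra.
by split; [move=> s; apply/is_derive_Reals; exact: d1 | split => //; apply/is_derive_Reals; exact: d2].
Qed.

Lemma M2_ge1 (d : nat) (M2 : R) : is_lub (M2_set d.+1) M2 -> 1 <= M2.
Proof.
move=> [ub _]; apply: ub; exists (fun i => if i == ord0 then 1 else 0).
have -> : (fun t => exp (- t) * \big[Rplus/R0]_(i < d.+1) ((if i == ord0 then 1 else 0) * t ^ i)) = fun t => exp (- t).
  apply: functional_extensionality => t; rewrite big_ord_recl big1 => [|i _]; last by rewrite /=; ring.
  by rewrite /=; ring.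
split=> [t t0|].
  rewrite Rabs_pos_eq; last exact: Rlt_le (exp_pos _).
  by rewrite -exp_0; case: t0 => [t0|<-]; [apply: Rlt_le; apply: exp_increasing; lra | rewrite Ropp_0; lra].
exists 0, (fun t => - exp (- t)), 1; split; first by lra.
split; first by move=> s; apply/is_derive_Reals; auto_derive => //; ring.
split; last by rewrite Rabs_R1.
by apply/is_derive_Reals; auto_derive => //; rewrite Ropp_0 exp_0; ring.
Qed.

(** Witness [(1 - t) exp (- t)], bounded because [|1 - t| <= 1 + t <= exp t]. This supplies the
    [2 <= M2] of [contraction_factor]. *)
Lemma M2_ge3 (d : nat) (M2 : R) : is_lub (M2_set d.+2) M2 -> 3 <= M2.
Proof.
move=> [ub _]; apply: ub.
exists (fun i : 'I_d.+2 => if val i is j.+1 then (if j is 0%nat then -1 else 0) else 1).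
set p := fun t : R => _.
have -> : p = fun t => exp (- t) * (1 - t).
  apply: functional_extensionality => t; rewrite /p !big_ord_recl big1 => [|i _]; last by rewrite /=; ring.
  by rewrite /=; ring.
split=> [t t0|].
  rewrite Rabs_mult (Rabs_pos_eq (exp _)); last exact: Rlt_le (exp_pos _).
  have h1 : Rabs (1 - t) <= 1 + t by apply: Rabs_le; lra.
  have h2 := exp_ineq1_le t.
  have h3 : exp (- t) * exp t = 1 by rewrite -exp_plus Rplus_opp_l exp_0.
  have := Rmult_le_compat_l _ _ _ (Rlt_le _ _ (exp_pos (- t))) (Rle_trans _ _ _ h1 h2).
  by rewrite h3.
exists 0, (fun t => exp (- t) * (t - 2)), 3; split; first by lra.
split; first by move=> s; apply/is_derive_Reals; auto_derive => //; ring.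
split; last by rewrite Rabs_pos_eq; lra.
by apply/is_derive_Reals; auto_derive => //; rewrite Ropp_0 exp_0; ring.
Qed.

(** * Taylor's formula with a bounded second derivative *)

Lemma second_bound_scaled (l : seq R) (M b : R) (q q1 q2 : R -> R) :
  second_bound l M -> 0 < b -> expsol l q -> derives q q1 -> derives q1 q2 ->
  (forall t, 0 <= t -> Rabs (q t) <= b) -> forall s, 0 <= s -> Rabs (q2 s) <= b * M.
Proof.
move=> bM b0 hq dq dq1 qb s s0.
have ib := Rinv_0_lt_compat _ b0.
have key k : k = 1 \/ k = -1 -> k * q2 s <= b * M.
  move=> hk.
  have hQ : expsol l (fun t => k * / b * q (t + s)).
    have h := expsol_shift s hq.
    by apply: chain_eq (expsol_lin (k * / b) 0 h h) _ _ => t //; ring.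
  have h := bM _ _ _ hQ (derives_scal _ (derives_shift s dq)) (derives_scal _ (derives_shift s dq1)).
  have {}h : k * / b * q2 (0 + s) <= M.
    apply: h => t t0; rewrite Rabs_mult.
    have -> : Rabs (k * / b) = / b.
      rewrite Rabs_mult (Rabs_pos_eq (/ b)); last by lra.
      by case: hk => ->; rewrite ?Rabs_Ropp Rabs_R1; ring.
    have := Rmult_le_compat_l _ _ _ (Rlt_le _ _ ib) (qb (t + s) ltac:(lra)).
    by rewrite Rinv_l; lra.
  rewrite Rplus_0_l in h; have := Rmult_le_compat_l _ _ _ (Rlt_le _ _ b0) h.
  by have -> : b * (k * / b * q2 s) = k * q2 s by [field; lra].
have k1 := key 1 (or_introl erefl); have k2 := key (-1) (or_intror erefl).
by apply: Rabs_le; lra.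
Qed.

Lemma taylor_bound (l : seq R) (M b sigma : R) (q q1 : R -> R) :
  second_bound l M -> 0 < b -> 0 < sigma -> expsol l q -> derives q q1 ->
  (forall t, 0 <= t -> Rabs (q t) <= b) ->
  Rabs (q 0 + sigma * q1 0) <= b * (1 + sigma * sigma * M / 2).
Proof.
move=> bM b0 s0 hq dq qb.
have [q2 dq1] : exists q2, derives q1 q2.
  have [f df hf] := expsol_deriv hq; have [g dg _] := expsol_deriv hf.
  by exists g; rewrite (derives_uniq dq df).
have q2b := second_bound_scaled bM b0 hq dq dq1 qb.
have key k : k = 1 \/ k = -1 -> k * (q 0 + sigma * q1 0) <= b * (1 + sigma * sigma * M / 2).
  move=> hk.
  (* The tangent at [t], evaluated at [sigma], minus the largest possible Taylor remainder: it is
     nondecreasing, and at [sigma] it equals [k q(sigma) <= b]. *)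
  pose W t := k * (q t + (sigma - t) * q1 t) + - (b * M / 2) * ((sigma - t) * (sigma - t)).
  pose W' t := (sigma - t) * (k * q2 t + b * M).
  have dW : derives W W'.
    have dl : derives (fun t => sigma - t) (fun=> -1) by move=> t; auto_derive => //; ring.
    move=> t; have := derives_lin k (- (b * M / 2)) (derives_lin 1 1 dq (derives_mul dl dq1)) (derives_mul dl dl) t.
    have -> : (fun t0 => k * (1 * q t0 + 1 * ((sigma - t0) * q1 t0)) + - (b * M / 2) * ((sigma - t0) * (sigma - t0))) = W.
      by apply: functional_extensionality => u; rewrite /W; ring.
    by move=> h; apply: is_derive_eq h _; rewrite /W'; field.
  have [s hs e] := derives_mvt dW s0.
  have Wpos : 0 <= W' s * (sigma - 0).
    apply: Rmult_le_pos; last by lra.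
    apply: Rmult_le_pos; first by lra.
    have := q2b s ltac:(lra); move: (Rle_abs (q2 s)) (Rle_abs (- q2 s)); rewrite Rabs_Ropp.
    by case: hk => ->; lra.
  have qs : k * q sigma <= b.
    have := qb sigma ltac:(lra); move: (Rle_abs (q sigma)) (Rle_abs (- q sigma)); rewrite Rabs_Ropp.
    by case: hk => ->; lra.
  have : W 0 <= W sigma by lra.
  rewrite /W Rminus_diag; lra.
have k1 := key 1 (or_introl erefl); have k2 := key (-1) (or_intror erefl).
by apply: Rabs_le; lra.
Qed.

Lemma expsol_expmul (l : seq R) (e : R) : forall q : R -> R, expsol l q ->
  expsol [seq a - e | a <- l] (fun t => exp (e * t) * q t).
Proof.
elim: l => [|a l IH] q /=.
  by rewrite /expsol /= => ->; apply: functional_extensionality => t; ring.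
move=> [q1 dq /IH h]; exists (fun t => exp (e * t) * q1 t) => // t.
by apply: is_derive_eq (derives_mul (derives_exp e) dq t) _; ring.
Qed.

(** * Linear flows *)

Definition mderives (n m : nat) (x x' : R -> 'M[R]_(n, m)) : Prop :=
  forall i j, derives (fun t => x t i j) (fun t => x' t i j).

Lemma derives_eq (f f' g g' : R -> R) : derives f f' -> f =1 g -> f' =1 g' -> derives g g'.
Proof. by move=> h /functional_extensionality <- /functional_extensionality <-. Qed.

Lemma derives_const (c : R) : derives (fun=> c) (fun=> 0).
Proof. by move=> t; auto_derive. Qed.

Section Flow.
Import GRing.Theory.
Local Open Scope ring_scope.

Lemma mderives_mull (p n m : nat) (A : 'M[R]_(p, n)) (x x' : R -> 'M[R]_(n, m)) :
  mderives x x' -> mderives (fun t => A *m x t) (fun t => A *m x' t).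
Proof.
move=> dx i j.
have h : derives (fun t => \big[Rplus/R0]_(k < n) Rmult (A i k) (x t k j))
            (fun t => \big[Rplus/R0]_(k < n) Rmult (A i k) (x' t k j)).
  by apply: derives_sum => k; apply: derives_scal; exact: dx.
by apply: derives_eq h _ _ => t; rewrite mxE.
Qed.

Lemma mderives_mulr (p n m : nat) (A : 'M[R]_(m, p)) (x x' : R -> 'M[R]_(n, m)) :
  mderives x x' -> mderives (fun t => x t *m A) (fun t => x' t *m A).
Proof.
move=> dx i j.
have h : derives (fun t => \big[Rplus/R0]_(k < m) Rmult (A k j) (x t i k))
            (fun t => \big[Rplus/R0]_(k < m) Rmult (A k j) (x' t i k)).
  by apply: derives_sum => k; apply: derives_scal; exact: dx.
by apply: derives_eq h _ _ => t; rewrite mxE; apply: eq_bigr => k _; exact: Rmult_comm.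
Qed.

Lemma mderives_lin (n m : nat) (c1 c2 : R) (x x' y y' : R -> 'M[R]_(n, m)) :
  mderives x x' -> mderives y y' ->
  mderives (fun t => c1 *: x t + c2 *: y t) (fun t => c1 *: x' t + c2 *: y' t).
Proof.
by move=> dx dy i j; apply: derives_eq (derives_lin c1 c2 (dx i j) (dy i j)) _ _ => t; rewrite !mxE.
Qed.

Lemma mderives_eq (n m : nat) (x x' z z' : R -> 'M[R]_(n, m)) :
  mderives x x' -> x =1 z -> x' =1 z' -> mderives z z'.
Proof. by move=> h /functional_extensionality <- /functional_extensionality <-. Qed.

Lemma scalar_ode_zero (lam : R) (f : R -> R) :
  derives f (fun t => Rmult lam (f t)) -> f 0 = 0 -> forall t, f t = 0.
Proof.
move=> df f0 t; suff -> : f = fun=> 0 by [].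
apply: (@zer_expsol [:: Ropp lam] f (Ropp 1)).
  exists (fun=> 0%R) => //; apply: derives_eq df _ _ => // u /=; ring.
by exists 0%R => //; lra.
Qed.

Lemma scalar_ode (lam c : R) (g g' : R -> R) : derives g g' ->
  exists2 f, f 0 = c & derives f (fun t => Rplus (Rmult lam (f t)) (g t)).
Proof.
move=> dg; have [f df] := first_order_ode (Ropp lam) dg.
exists (fun t => Rplus (Rmult 1 (f t)) (Rmult (Rminus c (f 0)) (exp (Rmult lam t)))).
  by rewrite Rmult_0_r exp_0; ring.
by apply: derives_eq (derives_lin 1 (Rminus c (f 0)) df (derives_exp lam)) _ _ => t //; ring.
Qed.

(** The characteristic polynomial at [A], kept as a product so that [linear_flow] can peel off one
    eigenvalue at a time. *)
Fixpoint shift_prod (n : nat) (A : 'M[R]_n) (l : seq R) : 'M[R]_n :=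
  if l is lam :: l' then shift_prod A l' *m (A - lam%:M) else 1%:M.

(* With [y] the flow of [(A - lam) X], which exists by induction, solve
   [x' = lam x + y] entrywise; then [(A - lam) x - y] solves [w' = lam w], [w(0) = 0]. *)
Lemma linear_flow (n m : nat) (A : 'M[R]_n) (l : seq R) : forall X : 'M[R]_(n, m),
  shift_prod A l *m X = 0 ->
  exists x : R -> 'M[R]_(n, m), [/\ x 0 = X, mderives x (fun t => A *m x t) &
    forall i j, expsol [seq Ropp lam | lam <- l] (fun t => x t i j)].
Proof.
elim: l => [|lam l IH] X /=.
  rewrite mul1mx => ->; exists (fun=> 0); split => // [i j|i j].
    by apply: derives_eq (derives_const 0) _ _ => t; rewrite ?mulmx0 mxE.
  by apply: functional_extensionality => t; rewrite mxE.
rewrite -mulmxA => /IH [y [y0 dy hy]].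
have /fin_all_exists [f hf] i : exists f : 'I_m -> R -> R, forall j,
    f j 0 = X i j /\ derives (f j) (fun t => Rplus (Rmult lam (f j t)) (y t i j)).
  have /fin_all_exists [f hf] j : exists f : R -> R,
      f 0 = X i j /\ derives f (fun t => Rplus (Rmult lam (f t)) (y t i j)).
    by have [f f0 df] := scalar_ode lam (X i j) (dy i j); exists f.
  by exists f.
pose x t : 'M[R]_(n, m) := \matrix_(i, j) f i j t.
have xt t : x t = 1 *: x t + 0 *: x t by rewrite scale1r scale0r addr0.
have dx : mderives x (fun t => lam *: x t + y t).
  by move=> i j; apply: derives_eq (proj2 (hf i j)) _ _ => t; rewrite !mxE.
have x0 : x 0 = X by apply/matrixP => i j; rewrite mxE; exact: (proj1 (hf i j)).
pose w t := 1 *: ((A - lam%:M) *m x t) + (-1) *: y t.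
have dw : mderives w (fun t => lam *: w t).
  apply: mderives_eq (mderives_lin 1 (-1) (mderives_mull (A - lam%:M) dx) dy) _ _ => // t.
  rewrite /w !scale1r !scaleN1r mulmxDr -scalemxAr [X in _ + X - _]mulmxBl mul_scalar_mx.
  by rewrite addrA addrAC addrK scalerBr.
have w0 t : w t = 0.
  apply/matrixP => i j; rewrite [RHS]mxE; apply: (@scalar_ode_zero lam (fun t => w t i j)).
    by apply: derives_eq (dw i j) _ _ => // u; rewrite mxE.
  by rewrite /w x0 y0 scale1r scaleN1r subrr mxE.
have Ax t : lam *: x t + y t = A *m x t.
  have := w0 t; rewrite /w scale1r scaleN1r mulmxBl mul_scalar_mx => /eqP.
  by rewrite subr_eq0 subr_eq addrC => /eqP.
exists x; split => //; first by apply: mderives_eq dx _ _.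
move=> i j; exists (fun t => y t i j); last exact: hy.
apply: derives_eq (dx i j) _ _ => // t; rewrite !mxE.
change (Rplus (Rmult lam (f i j t)) (y t i j) = Rminus (y t i j) (Rmult (Ropp lam) (f i j t))); ring.
Qed.

End Flow.

Definition sqnorm (n : nat) (v : 'cV[R]_n) : R := \big[Rplus/R0]_(i < n) (v i ord0 * v i ord0).

Lemma sqnorm_ge0 (n : nat) (v : 'cV[R]_n) : 0 <= sqnorm v.
Proof. by apply: Rsum_ge0 => i; exact: Rle_0_sqr. Qed.

Lemma sqnorm_coord (n : nat) (v : 'cV[R]_n) (i : 'I_n) : v i ord0 * v i ord0 <= sqnorm v.
Proof.
rewrite /sqnorm (bigD1 i) //=; set s := \big[_/_]_(_ | _) _.
suff : 0 <= s by lra.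
by apply: (big_ind (Rle 0)) => [|x y hx hy|j _]; [lra | lra | exact: Rle_0_sqr].
Qed.

(** Gronwall: [2 x_i A_ij x_j <= a (x_i^2 + x_j^2)], and summation over [i] and [j] gives
    [2 n a |x|^2]. *)
Lemma sqnorm_growth (n : nat) (A : 'M[R]_n) (a : R) (x : R -> 'cV[R]_n) :
  (forall i j, Rabs (A i j) <= a) -> mderives x (fun t => mulmx A (x t)) ->
  forall t, 0 <= t -> sqnorm (x t) <= sqnorm (x 0) * exp (2 * INR n * a * t).
Proof.
move=> hA dx t t0; pose K := 2 * INR n * a.
pose S' t := \big[Rplus/R0]_(i < n) (mulmx A (x t) i ord0 * x t i ord0 + x t i ord0 * mulmx A (x t) i ord0).
have dS : derives (fun t => sqnorm (x t)) S'.
  by apply: derives_sum => i; apply: derives_mul; exact: dx.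
have hS u : S' u <= K * sqnorm (x u).
  pose X i := x u i ord0 * x u i ord0.
  have h1 i : mulmx A (x u) i ord0 * x u i ord0 + x u i ord0 * mulmx A (x u) i ord0 <=
      \big[Rplus/R0]_(j < n) (a * X i + a * X j).
    have -> : mulmx A (x u) i ord0 * x u i ord0 + x u i ord0 * mulmx A (x u) i ord0 =
       2 * x u i ord0 * mulmx A (x u) i ord0 by ring.
    rewrite mxE big_distrr; apply: Rsum_le => j /=.
    change (2 * x u i ord0 * (A i j * x u j ord0) <= a * X i + a * X j).
    rewrite /X; have := hA i j; move: (A i j) (x u i ord0) (x u j ord0) => k p q hk.
    have := Rle_0_sqr (p - q); have := Rle_0_sqr (p + q); rewrite /Rsqr.
    move: (Rle_abs k) (Rle_abs (- k)); rewrite Rabs_Ropp => k1 k2 s1 s2.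
    have := Rmult_le_pos (a - k) _ ltac:(lra) s1.
    have := Rmult_le_pos (a + k) _ ltac:(lra) s2; lra.
  apply: Rle_trans (Rsum_le h1) _; right.
  under eq_bigr => i _ do rewrite big_split.
  rewrite big_split /=.
  have e1 : \big[Rplus/R0]_(i < n) \big[Rplus/R0]_(j < n) (a * X j) = INR n * a * sqnorm (x u).
    rewrite -big_distrr /= -/(sqnorm (x u)) big_const_ord Rmult_assoc.
    elim: (n) (a * sqnorm _) => [|k IH] z; first by rewrite /=; lra.
    by rewrite iterS IH S_INR; ring.
  by rewrite exchange_big /= e1 /K; ring.
have dF := derives_mul (derives_exp (- K)) dS.
have [->|tp] := Req_dec t 0; first by rewrite Rmult_0_r exp_0; lra.
have [|c hc] := derives_mvt dF (a := 0) (b := t); first by lra.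
rewrite Rmult_0_r exp_0 Rmult_1_l => e.
have : (- K * exp (- K * c) * sqnorm (x c) + exp (- K * c) * S' c) * (t - 0) <= 0.
  have h1 : 0 <= exp (- K * c) * (K * sqnorm (x c) - S' c) * (t - 0).
    apply: Rmult_le_pos; last by lra.
    by apply: Rmult_le_pos; [exact: Rlt_le (exp_pos _) | have := hS c; lra].
  lra.
rewrite -e => h; apply: (Rmult_le_reg_l (exp (- K * t))); first exact: exp_pos.
rewrite -/K (Rmult_comm (sqnorm (x 0))) -Rmult_assoc -exp_plus.
have -> : - K * t + K * t = 0 by ring.
by rewrite exp_0; lra.
Qed.

Lemma linear_ode_zero (n : nat) (A : 'M[R]_n) (x : R -> 'cV[R]_n) :
  mderives x (fun t => mulmx A (x t)) -> x 0 = GRing.zero -> forall t, 0 <= t -> x t = GRing.zero.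
Proof.
move=> dx x0 t t0.
have [a ha] : exists a, forall i j, Rabs (A i j) <= a.
  exists (\big[Rplus/R0]_i \big[Rplus/R0]_j Rabs (A i j)) => i j.
  rewrite (bigD1 i) //= (bigD1 j) //=.
  set s1 := \big[_/_]_(_ | _) _; set s2 := \big[_/_]_(_ | _) _.
  have : 0 <= s1 by apply: (big_ind (Rle 0)) => [|u v hu hv|k _]; [lra | lra | exact: Rabs_pos].
  have : 0 <= s2.
    apply: (big_ind (Rle 0)) => [|u v hu hv|k _]; [lra | lra | apply: Rsum_ge0 => ?; exact: Rabs_pos].
  lra.
have := sqnorm_growth ha dx t0.
have -> : sqnorm (x 0) = 0 by rewrite x0 /sqnorm big1 // => i _; rewrite mxE; exact: Rmult_0_l.
rewrite Rmult_0_l => h; apply/matrixP => i j; rewrite [RHS]mxE.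
have -> : j = ord0 by rewrite ord1; apply: val_inj.
have := sqnorm_coord (x t) i => h2.
by apply: Rsqr_0_uniq; rewrite /Rsqr; have := Rle_0_sqr (x t i ord0); rewrite /Rsqr; lra.
Qed.

(* A kernel vector of [E t] would be transported back to [0] by the flow of [- A]. *)
Lemma flow_unit (n : nat) (A : 'M[R]_n) (E : R -> 'M[R]_n) (t : R) :
  E 0 = scalar_mx 1 -> mderives E (fun t => mulmx A (E t)) -> 0 <= t -> E t \in unitmx.
Proof.
move=> E0 dE t0; rewrite -unitmx_tr unitmxE GRing.unitfE; apply/negP => /det0P [v v0 vE].
case/negP: v0; apply/eqP; apply: trmx_inj; rewrite trmx0.
have Ev : mulmx (E t) (trmx v) = GRing.zero by apply: trmx_inj; rewrite trmx_mul trmxK trmx0.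
pose z s := mulmx (E (- s + t)) (trmx v).
have dz : mderives z (fun s => mulmx (GRing.opp A) (z s)).
  have d1 : mderives (fun s => E (- s + t)) (fun s => mulmx (GRing.opp A) (E (- s + t))).
    move=> i j.
    have := derives_scale (-1) (derives_shift t (dE i j)) => h.
    have negs s : -1 * s = - s by ring.
    by apply: derives_eq h _ _ => s; rewrite negs // mulNmx [RHS]mxE negs.
  by apply: mderives_eq (mderives_mulr (trmx v) d1) _ _ => s //; rewrite mulmxA.
have := linear_ode_zero dz _ t0; rewrite /z Rplus_opp_l E0 mul1mx; apply.
by rewrite Ropp_0 Rplus_0_l.
Qed.

(** * Piecewise constant switching *)

Lemma geom_cover (e : R) (n : nat) : 0 < e ->
  sum_f_R0 (fun k => e * (/ 2) ^ k.+1) n <= e.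
Proof.
move=> e0; have -> : sum_f_R0 (fun k => e * (/ 2) ^ k.+1) n = e - e * (/ 2) ^ n.+1.
  by elim: n => [|n IH] /=; [field | rewrite IH /=; field].
have : 0 < e * (/ 2) ^ n.+1 by apply: Rmult_lt_0_compat => //; apply: pow_lt; lra.
lra.
Qed.

Lemma geom_gap (e : R) (k : nat) : 0 < e -> 0 < e * (/ 2) ^ k.+1.
Proof. by move=> e0; apply: Rmult_lt_0_compat => //; apply: pow_lt; lra. Qed.

Section Breakpoints.
Variable T : nat -> R.
Hypotheses (T0 : T 0%nat = 0) (T_lt : forall k, T k < T k.+1)
  (T_unbounded : forall B, exists k, B < T k).

Lemma breakpoints_mono (i j : nat) : (i <= j)%nat -> T i <= T j.
Proof.
move=> /subnK <-; elim: (j - i)%nat => [|k IH]; first by rewrite add0n; lra.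
by rewrite addSn; have := T_lt (k + i); lra.
Qed.

Lemma breakpoints_ge0 (k : nat) : 0 <= T k.
Proof. by rewrite -T0; exact: breakpoints_mono. Qed.

Lemma breakpoints_locate (t : R) : 0 <= t -> exists k, T k <= t < T k.+1.
Proof.
move=> t0; have [k] := T_unbounded t; elim: k => [|k IH] h; first by rewrite T0 in h; lra.
by case: (Rlt_le_dec t (T k)) => [/IH //|hk]; exists k.
Qed.

Lemma breakpoints_uniq (t : R) (i j : nat) :
  T i <= t < T i.+1 -> T j <= t < T j.+1 -> i = j.
Proof.
move=> hi hj; case: (ltngtP i j) => // h; have := breakpoints_mono h; lra.
Qed.

(** The superlevel set is a union of pieces [[T k, T k.+1)]. Extending each to the left by
    [e / 2^(k+1)] gives an open set with excess at most [e]. *)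
Lemma step_meas (f : R -> R) (v : nat -> R) :
  (forall k t, T k <= t < T k.+1 -> f t = v k) -> meas_fun f.
Proof.
move=> hf c e e0.
pose gap k := e * (/ 2) ^ k.+1.
have gap0 k : 0 < gap k by exact: geom_gap.
exists (fun t => exists k, c < v k /\ T k - gap k < t < T k.+1); split; last split.
- move=> t [k [ck hk]]; exists (Rmin (t - (T k - gap k)) (T k.+1 - t)); split.
    by apply: Rmin_glb_lt; lra.
  move=> y hy; exists k; split => //.
  have h1 := Rmin_l (t - (T k - gap k)) (T k.+1 - t).
  have h2 := Rmin_r (t - (T k - gap k)) (T k.+1 - t).
  by have := Rabs_def2 _ _ hy; lra.
- move=> t [t0 ct]; have [k hk] := breakpoints_locate t0.
  by exists k; rewrite -(hf k t hk); split => //; have := gap0 k; lra.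
- exists (fun k => T k - gap k), T; split; first by move=> k; have := gap0 k; lra.
  split; last first.
    move=> n; apply: Rle_trans (geom_cover n e0); right; apply: sum_eq => i _.
    by rewrite /gap; ring.
  move=> t [[k [ck hk]] nE]; exists k; split; first by lra.
  apply: Rnot_le_lt => hT; apply: nE; split.
    by have := breakpoints_ge0 k; lra.
  by rewrite (hf k t) //; lra.
Qed.

Lemma breakpoints_null : null_set (fun t => exists k, t = T k).
Proof.
move=> e e0; pose gap k := e * (/ 2) ^ k.+1 / 2.
have gap0 k : 0 < gap k by have := geom_gap k e0; rewrite /gap; lra.
exists (fun k => T k - gap k), (fun k => T k + gap k); split; first by move=> k; have := gap0 k; lra.
split; first by move=> t [k ->]; exists k; have := gap0 k; lra.
move=> n; apply: Rle_trans (geom_cover n e0); right; apply: sum_eq => i _.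
by rewrite /gap; field.
Qed.

(** [g''] provides the continuity of [g'], so [|g'|] attains a maximum on [[a, b]], the Lipschitz
    constant. *)
Lemma lipschitz_piece (g g' g'' : R -> R) (a b : R) : derives g g' -> derives g' g'' -> a <= b ->
  exists2 L, 0 <= L & forall s t, a <= s -> s <= t -> t <= b -> Rabs (g t - g s) <= L * (t - s).
Proof.
move=> dg dg' ab.
have [Mx [hM _]] : exists Mx, (forall c, a <= c <= b -> Rabs (g' c) <= Rabs (g' Mx)) /\ a <= Mx <= b.
  apply: (continuity_ab_maj (fun t => Rabs (g' t)) a b ab) => c _.
  apply: (continuity_pt_comp g' Rabs); last exact: Rcontinuity_abs.
  by apply: derivable_continuous_pt; exists (g'' c); apply/is_derive_Reals; exact: dg'.
exists (Rabs (g' Mx)); first exact: Rabs_pos.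
move=> s t hs st ht; case: (Req_dec s t) => [->|ne].
  by rewrite !Rminus_diag Rabs_R0; lra.
have [|c hc ->] := derives_mvt dg (a := s) (b := t); first by lra.
rewrite Rabs_mult (Rabs_pos_eq (t - s)); last by lra.
by apply: Rmult_le_compat_r; [lra | apply: hM; lra].
Qed.

Lemma abs_cont_piecewise (f : R -> R) (g g' g'' : nat -> R -> R) :
  (forall k, derives (g k) (g' k)) -> (forall k, derives (g' k) (g'' k)) ->
  (forall k t, T k <= t <= T k.+1 -> f t = g k t) -> abs_cont f.
Proof.
move=> dg dg' hf.
have lip k : exists2 L, 0 <= L & forall s t, 0 <= s -> s <= t -> t <= T k -> Rabs (f t - f s) <= L * (t - s).
  elim: k => [|k [L1 L10 h1]].
    exists 0; first by lra.
    move=> s t; rewrite T0 => s0 st t0; have -> : s = t by lra.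
    by rewrite Rminus_diag Rabs_R0; lra.
  have [L2 L20 h2] := lipschitz_piece (dg k) (dg' k) (Rlt_le _ _ (T_lt k)).
  have {}h2 s t : T k <= s -> s <= t -> t <= T k.+1 -> Rabs (f t - f s) <= L2 * (t - s).
    by move=> hs st ht; rewrite !(hf k); [exact: h2 | lra | lra].
  exists (L1 + L2); first by lra.
  move=> s t s0 st tT.
  case: (Rle_lt_dec t (T k)) => htk.
    have := h1 s t s0 st htk; have := Rmult_le_pos L2 (t - s) L20 ltac:(lra); lra.
  case: (Rle_lt_dec (T k) s) => hsk.
    have := h2 s t hsk st tT; have := Rmult_le_pos L1 (t - s) L10 ltac:(lra); lra.
  have b1 := h1 s (T k) s0 ltac:(lra) (Rle_refl _).
  have b2 := h2 (T k) t (Rle_refl _) ltac:(lra) tT.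
  have := Rabs_triang (f t - f (T k)) (f (T k) - f s).
  have -> : f t - f (T k) + (f (T k) - f s) = f t - f s by ring.
  have := Rmult_le_pos L1 (t - T k) L10 ltac:(lra).
  have := Rmult_le_pos L2 (T k - s) L20 ltac:(lra); lra.
move=> Tm e Tm0 e0; have [k hk] := T_unbounded Tm; have [L L0 hL] := lip k.
exists (e / (L + 1)); split; first by apply: Rdiv_lt_0_compat; lra.
move=> l hl hd.
suff [h1 h2] : List.fold_right (fun p acc => Rabs (f (snd p) - f (fst p)) + acc) 0 l <=
    L * List.fold_right (fun p acc => (snd p - fst p) + acc) 0 l /\
    0 <= List.fold_right (fun p acc => (snd p - fst p) + acc) 0 l.
  set S := List.fold_right (fun p acc => snd p - fst p + acc) 0 l in hd h1 h2 *.
  have : S * (L + 1) < e / (L + 1) * (L + 1) by apply: Rmult_lt_compat_r => //; lra.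
  have -> : e / (L + 1) * (L + 1) = e by field; lra.
  lra.
have [lo lo0 {}hl] : exists2 lo, 0 <= lo & intervals_in lo Tm l by exists 0 => //; lra.
elim: l lo lo0 hl {hd} => [|[a b] l IH] lo lo0 /=; first by lra.
move=> [h1 [h2 [h3 /IH [|h4 h5]]]]; first by lra.
have := hL a b ltac:(lra) h2 ltac:(lra); rewrite /=; lra.
Qed.

Fixpoint switched_state (n : nat) (E : nat -> R -> 'M[R]_n) (x0 : 'cV[R]_n) (k : nat) : 'cV[R]_n :=
  if k is k'.+1 then mulmx (E k' (T k - T k')) (switched_state E x0 k') else x0.

Lemma piecewise_trajectory (n : nat) (Sx : 'M[R]_n -> Prop) (A : nat -> 'M[R]_n)
    (E : nat -> R -> 'M[R]_n) (x0 : 'cV[R]_n) :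
  (forall k, Sx (A k)) -> (forall k, E k 0 = scalar_mx 1) ->
  (forall k, mderives (E k) (fun t => mulmx (A k) (E k t))) ->
  exists2 x, trajectory Sx x & forall k i, x (T k) i = switched_state E x0 k i ord0.
Proof.
move=> hA E0 dE.
have [kap hkap] : exists kap : R -> nat, forall t, 0 <= t -> T (kap t) <= t < T (kap t).+1.
  apply: (functional_choice (fun t k => 0 <= t -> T k <= t < T k.+1)) => t.
  case: (Rle_lt_dec 0 t) => ht; last by exists 0%nat; lra.
  by have [k hk] := breakpoints_locate ht; exists k.
pose y := switched_state E x0.
pose z k t : 'cV[R]_n := mulmx (E k (t + - T k)) (y k).
pose x t i := z (kap t) t i ord0.
have kapE k t : T k <= t < T k.+1 -> kap t = k.
  move=> h; have t0 : 0 <= t by have := breakpoints_ge0 k; lra.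
  exact: breakpoints_uniq (hkap t t0) h.
have dz k : mderives (z k) (fun t => mulmx (A k) (z k t)).
  have d1 : mderives (fun t => E k (t + - T k)) (fun t => mulmx (A k) (E k (t + - T k))).
    by move=> i j; exact: derives_shift (dE k i j).
  by apply: mderives_eq (mderives_mulr (y k) d1) _ _ => t //; rewrite mulmxA.
have xz k t i : T k <= t <= T k.+1 -> x t i = z k t i ord0.
  move=> [h1 [h2|->]]; first by rewrite /x (kapE k).
  rewrite /x (kapE k.+1); last by have := T_lt k.+1; lra.
  by rewrite /z Rplus_opp_r E0 mul1mx /y /=.
exists x; last first.
  move=> k i; rewrite (xz k); last by have := T_lt k; lra.
  by rewrite /z Rplus_opp_r E0 mul1mx.
split.
  move=> i; apply: (@abs_cont_piecewise _ (fun k t => z k t i ord0)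
      (fun k t => mulmx (A k) (z k t) i ord0) (fun k t => mulmx (A k) (mulmx (A k) (z k t)) i ord0)) => k.
  - exact: dz.
  - exact: (mderives_mull (A k) (dz k)).
  - by move=> t; exact: xz.
exists (fun t => A (kap t)); split.
  split=> [t t0|i j]; first exact: hA.
  by apply: (@step_meas _ (fun k => A k i j)) => k t h; rewrite (kapE k).
exists (fun t => exists k, t = T k); split; first exact: breakpoints_null.
move=> t t0 nT i; have [k hk] := breakpoints_locate (Rlt_le _ _ t0).
have hk' : T k < t < T k.+1.
  by case: (Req_dec (T k) t) => e; [case: nT; exists k | lra].
have -> : \big[Rplus/R0]_(j < n) (A (kap t) i j * x t j) = mulmx (A k) (z k t) i ord0.
  by rewrite mxE (kapE k t hk); apply: eq_bigr => j _; rewrite /x (kapE k t hk).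
apply/is_derive_Reals; apply: (is_derive_ext_loc (fun s => z k s i ord0)); last exact: dz.
have r0 : 0 < Rmin (t - T k) (T k.+1 - t) by apply: Rmin_glb_lt; lra.
exists (mkposreal _ r0) => s; rewrite /ball /= /AbsRing_ball /abs /minus /plus /opp /= => hs.
symmetry; apply: xz.
have h1 := Rmin_l (t - T k) (T k.+1 - t); have h2 := Rmin_r (t - T k) (T k.+1 - t).
by have := Rabs_def2 _ _ hs; lra.
Qed.

End Breakpoints.

(** * Spectra and the joint spectral radius *)

Section Algebra.
Import Order.TTheory GRing.Theory Num.Theory.
Local Open Scope ring_scope.

Lemma defs_det (n : nat) (A : 'M[R]_n) : Defs.det A = \det A.
Proof.
by apply: eq_bigr => s _; congr (Rmult _ _); case: (odd_perm s); rewrite ?expr1 ?expr0.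
Qed.

Lemma defs_mxid (n : nat) : mxid n = 1%:M :> 'M[R]_n.
Proof. by apply/matrixP => i j; rewrite !mxE; case: (i == j). Qed.

Lemma defs_mxmul (n : nat) (A B : 'M[R]_n) : mxmul A B = A *m B.
Proof. by apply/matrixP => i j; rewrite !mxE. Qed.

Lemma poly_horner_inj (F : numFieldType) (p q : {poly F}) : (forall z, p.[z] = q.[z]) -> p = q.
Proof.
move=> h; apply/eqP; rewrite -subr_eq0; apply/eqP.
apply: (@roots_geq_poly_eq0 _ _ [seq k%:R | k <- seq.iota 0 (size (p - q))]).
- by apply/allP => z _; rewrite rootE hornerD hornerN h subrr.
- rewrite map_inj_uniq ?iota_uniq // => i j /eqP; rewrite eqr_nat => /eqP //.
- by rewrite size_map size_iota.
Qed.

(** [real_eigs] equates values at real numbers; Cayley-Hamilton needs equality of polynomials, which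
    infinitely many values give. *)
Lemma real_eigs_char_poly (n : nat) (A : 'M[R]_n) (lam : 'I_n -> R) : real_eigs A lam ->
  char_poly A = \prod_(i < n) ('X - (lam i)%:P).
Proof.
move=> h; apply: poly_horner_inj => z; rewrite -horner_evalE -det_map_mx.
have -> : map_mx (horner_eval z) (char_poly_mx A) = \matrix_(i, j) (Rminus (Rmult z (mxid n i j)) (A i j)).
  apply/matrixP => i j; rewrite !mxE horner_evalE hornerD hornerN hornerC hornerMn hornerX.
  change (z *+ (i == j) - A i j = z * (if i == j then 1 else 0) - A i j).
  by case: (i == j); rewrite ?mulr1 ?mulr0.
rewrite -defs_det h horner_prod; apply: eq_bigr => i _.
by rewrite hornerD hornerN hornerC hornerX.
Qed.

Lemma shift_prod_horner (n : nat) (A : 'M[R]_n.+1) (l : seq R) :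
  shift_prod A l = horner_mx A (\prod_(c <- l) ('X - c%:P)).
Proof.
elim: l => [|c l IH] /=; first by rewrite big_nil; symmetry; exact: rmorph1.
by rewrite big_cons mulrC rmorphM /= IH rmorphB /= horner_mx_X horner_mx_C.
Qed.

Lemma eigs_flow (n : nat) (A : 'M[R]_n.+1) (lam : 'I_n.+1 -> R) : real_eigs A lam ->
  exists E : R -> 'M[R]_n.+1, [/\ E 0 = 1%:M, mderives E (fun t => A *m E t) &
    forall i j, expsol [seq Ropp (lam i) | i <- enum 'I_n.+1] (fun t => E t i j)].
Proof.
move=> h; have [|E [E0 dE hE]] := @linear_flow n.+1 n.+1 A [seq lam i | i <- enum 'I_n.+1] 1%:M.
  rewrite mulmx1 shift_prod_horner big_map big_enum /=.
  by rewrite -(real_eigs_char_poly h) Cayley_Hamilton.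
by exists E; split => // i j; have := hE i j; rewrite -map_comp.
Qed.

Lemma left_eigenvector (n : nat) (A : 'M[R]_n) (lam : 'I_n -> R) (i : 'I_n) :
  real_eigs A lam -> exists2 v : 'rV[R]_n, v != 0 & v *m A = lam i *: v.
Proof.
move=> h; have : eigenvalue A (lam i).
  rewrite eigenvalue_root_char (real_eigs_char_poly h) rootE horner_prod (bigD1 i) //=.
  by rewrite hornerD hornerN hornerC hornerX subrr mul0r.
by move=> /eigenvalueP [v hv v0]; exists v.
Qed.

(* By Cayley-Hamilton, the inverse of [M] is a polynomial in [M]. *)
Lemma invariant_preimage (n : nat) (V : 'cV[R]_n.+1 -> Prop) (M : 'M[R]_n.+1) :
  V 0 -> (forall c x y, V x -> V y -> V (c *: x + y)) -> M \in unitmx ->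
  (forall x, V x -> V (M *m x)) -> forall x, V (M *m x) -> V x.
Proof.
move=> V0 Vlin uM VM x Vx.
have Vh (q : {poly R}) y : V y -> V (horner_mx M q *m y).
  elim/poly_ind: q y => [|q c IH] y Vy; first by rewrite rmorph0 mul0mx.
  rewrite rmorphD rmorphM /= horner_mx_X horner_mx_C addrC mulmxDl mul_scalar_mx -mulmxA.
  by apply: Vlin => //; apply: IH; exact: VM.
have := Cayley_Hamilton M; have := char_poly_det M.
elim/poly_ind: (char_poly M) => [|q c _].
  rewrite coef0 => /esym /eqP; rewrite mulf_eq0 signr_eq0 /= => /eqP d0 _.
  by move: uM; rewrite unitmxE unitfE d0 eqxx.
rewrite coefD coefMX coefC /= add0r => cE.
have c0 : c != 0 by rewrite cE mulf_neq0 ?signr_eq0 // -unitfE -unitmxE.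
rewrite rmorphD rmorphM /= horner_mx_X horner_mx_C => e.
have ex : horner_mx M q *m (M *m x) = - c *: x.
  have := congr1 (fun Z => Z *m x) e; rewrite mul0mx mulmxDl mul_scalar_mx -mulmxA => /eqP.
  by rewrite addr_eq0 => /eqP ->; rewrite scaleNr.
have -> : x = (- c)^-1 *: (horner_mx M q *m (M *m x)) + 0.
  by rewrite ex scalerA mulVf ?oppr_eq0 // scale1r addr0.
by apply: Vlin => //; exact: Vh.
Qed.

End Algebra.

Lemma frob_bound (n : nat) (M : 'M[R]_n) (c : R) : 0 <= c -> (forall i j, Rabs (M i j) <= c) ->
  frob M <= INR n * c.
Proof.
move=> c0 h; rewrite -(sqrt_Rsqr (INR n * c)); last by apply: Rmult_le_pos => //; exact: pos_INR.
apply: sqrt_le_1_alt; rewrite /Rsqr.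
have cst m (z : R) : \big[Rplus/R0]_(i < m) z = INR m * z.
  rewrite big_const_ord; elim: m => [|k IH]; first by rewrite /=; lra.
  by rewrite iterS IH S_INR; ring.
have -> : INR n * c * (INR n * c) = \big[Rplus/R0]_(i < n) \big[Rplus/R0]_(j < n) (c * c).
  by rewrite !cst; ring.
apply: Rsum_le => i; apply: Rsum_le => j.
by have := Rsqr_le_abs_1 (M i j) c; rewrite (Rabs_pos_eq c) // /Rsqr; apply; exact: h.
Qed.

Lemma pow_lt_mono (x y : R) (n : nat) : 0 < x -> x < y -> x ^ n.+1 < y ^ n.+1.
Proof.
move=> x0 xy; elim: n => [|n IH]; first by rewrite !pow_1.
apply: (Rmult_gt_0_lt_compat x y (x ^ n.+1) (y ^ n.+1)) => //; first exact: pow_lt.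
exact: Rlt_trans xy.
Qed.

(** If the limit were at least 1, the roots would eventually exceed [eta], strictly between [theta]
    and 1. Then [eta^k < C theta^k] for all large [k], although [(eta / theta)^k] is unbounded. *)
Lemma geometric_jsr_lt1 (n : nat) (S : 'M[R]_n -> Prop) (K theta L : R) :
  0 < theta < 1 -> 0 < K ->
  (forall l : seq 'M[R]_n, (forall M, List.In M l -> S M) ->
     forall i j, Rabs (mxprod l i j) <= K * theta ^ length l) ->
  jsr_is S L -> L < 1.
Proof.
move=> [t0 t1] K0 hK [s [hs cv]]; apply: Rnot_le_lt => L1.
pose C := (INR n + 1) * K; have n0 := pos_INR n.
have C0 : 0 < C by apply: Rmult_lt_0_compat => //; lra.
have sle k : s k <= C * theta ^ k.+1.
  have [_ lub] := hs k; apply: lub => y [l [lk [lS ->]]].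
  have tp : 0 < theta ^ k.+1 by exact: pow_lt.
  have Kt : 0 <= K * theta ^ k.+1 by apply: Rmult_le_pos; lra.
  apply: Rle_trans (@frob_bound n _ (K * theta ^ k.+1) Kt _) _.
    by rewrite -lk; exact: hK.
  rewrite /C; lra.
have s0 k : 0 <= s k.
  have [ub lub] := hs k.
  have [[y hy]|ne] := classic (exists y, exists l, length l = k.+1 /\ (forall M, List.In M l -> S M) /\ y = frob (mxprod l)).
    by apply: Rle_trans (ub y hy); case: hy => l [_ [_ ->]]; exact: sqrt_pos.
  (* With no product at all, every real is an upper bound and there is no least one. *)
  have : s k <= s k - 1 by apply: lub => y hy; case: ne; exists y.
  lra.
pose eta := (1 + theta) / 2.
have [N hN] := cv (1 - eta) ltac:(rewrite /eta; lra).
have root k : (N <= k)%coq_nat -> eta ^ k.+1 < C * theta ^ k.+1.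
  move=> hk; apply: Rlt_le_trans (sle k).
  have := hN k hk; rewrite /R_dist => /Rabs_def2 [_ h].
  have {}h : eta < kroot (s k) k.+1 by lra.
  have e0 : 0 < eta by rewrite /eta; lra.
  (* [kroot] is 0 at 0, below [eta]; so here it is a genuine power. *)
  have sn : s k <> 0 by move=> e; move: h; rewrite /kroot; case: RIneq.Req_EM_T => [? /= h|/(_ e) //]; lra.
  have {}h : eta < Rpower (s k) (/ INR k.+1) by move: h; rewrite /kroot; case: RIneq.Req_EM_T.
  have sp : 0 < s k by have := s0 k; lra.
  have k0 : INR k.+1 <> 0 by apply: not_0_INR.
  have -> : s k = Rpower (s k) (/ INR k.+1) ^ k.+1.
    by rewrite -Rpower_pow ?Rpower_mult ?Rinv_l ?Rpower_1 //; exact: exp_pos.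
  exact: pow_lt_mono.
have q1 : 1 < eta / theta.
  apply: (Rmult_lt_reg_r theta) => //; have -> : eta / theta * theta = eta by field; lra.
  by rewrite /eta; lra.
have [m hm] := Pow_x_infinity (eta / theta) ltac:(rewrite Rabs_pos_eq; lra) C.
have := hm (m + N).+1 (elimT leP (leqW (leq_addr N m))) => h1.
have := root (m + N)%nat (elimT leP (leq_addl m N)) => h2.
have tp : 0 < theta ^ (m + N).+1 by exact: pow_lt.
rewrite Rabs_pos_eq in h1; last by apply: pow_le; lra.
have := Rmult_ge_compat_r _ _ _ (Rle_ge _ _ (Rlt_le _ _ tp)) h1.
rewrite -Rpow_mult_distr; have -> : eta / theta * theta = eta by field; lra.
lra.
Qed.

(** * Boundedness and contraction *)

Lemma exp_mono (x y : R) : x <= y -> exp x <= exp y.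
Proof. by case=> [/exp_increasing|->]; lra. Qed.

Section Family.
Variables (n : nat) (Sx : 'M[R]_n.+1 -> Prop) (E : 'M[R]_n.+1 -> R -> 'M[R]_n.+1).
Hypotheses (E0 : forall A, Sx A -> E A 0 = scalar_mx 1)
  (dE : forall A, Sx A -> mderives (E A) (fun t => mulmx A (E A t))).

Definition piece : Type := ('M[R]_n.+1 * R)%type.

(** Durations are strictly positive because they become the gaps between strictly increasing
    breakpoints. *)
Fixpoint valid (l : seq piece) : Prop :=
  if l is p :: l' then [/\ Sx p.1, 0 < p.2 & valid l'] else True.

Fixpoint dur (l : seq piece) : R := if l is p :: l' then p.2 + dur l' else 0.

(* The head of the list is the piece that acts first. *)
Fixpoint flow_prod (l : seq piece) : 'M[R]_n.+1 :=
  if l is p :: l' then mulmx (flow_prod l') (E p.1 p.2) else scalar_mx 1.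

Definition disc_prod (e : R) (l : seq piece) : 'M[R]_n.+1 :=
  GRing.scale (exp (e * dur l)) (flow_prod l).

Lemma valid_cat (l1 l2 : seq piece) : valid (l1 ++ l2) <-> valid l1 /\ valid l2.
Proof.
elim: l1 => [|p l IH] /=; first by split=> // -[].
by split=> [[h1 h2 /IH [h3 h4]]|[[h1 h2 h3] h4]]; split => //; apply/IH.
Qed.

Lemma valid_nth (l : seq piece) (p0 : piece) (k : nat) : valid l -> (k < size l)%nat ->
  Sx (nth p0 l k).1 /\ 0 < (nth p0 l k).2.
Proof. by elim: l k => [|p l IH] [|k] //= [h1 h2 h3] hk //; exact: IH. Qed.

Lemma dur_cat (l1 l2 : seq piece) : dur (l1 ++ l2) = dur l1 + dur l2.
Proof. by elim: l1 => [|p l IH] /=; [lra | rewrite IH; lra]. Qed.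

Lemma dur_ge0 (l : seq piece) : valid l -> 0 <= dur l.
Proof. by elim: l => [|p l IH] /= => [_|[h1 h2 /IH]]; lra. Qed.

Lemma flow_prod_cat (l1 l2 : seq piece) : flow_prod (l1 ++ l2) = mulmx (flow_prod l2) (flow_prod l1).
Proof. by elim: l1 => [|p l IH] /=; [rewrite mulmx1 | rewrite IH mulmxA]. Qed.

Lemma disc_prod_cat (e : R) (l1 l2 : seq piece) :
  disc_prod e (l1 ++ l2) = mulmx (disc_prod e l2) (disc_prod e l1).
Proof.
rewrite /disc_prod dur_cat flow_prod_cat -scalemxAl -scalemxAr GRing.scalerA.
by congr GRing.scale; rewrite Rmult_plus_distr_l exp_plus Rmult_comm.
Qed.

Lemma disc_prod_coord (e : R) (l : seq piece) (x : 'cV[R]_n.+1) (i : 'I_n.+1) :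
  mulmx (disc_prod e l) x i ord0 = exp (e * dur l) * mulmx (flow_prod l) x i ord0.
Proof. by rewrite /disc_prod -scalemxAl mxE. Qed.

(* The norm of [x] in which the system discounted by [e] is nonexpansive is the least
   such [b]; only upper bounds for it are ever needed. *)
Definition orbit_bound (e : R) (x : 'cV[R]_n.+1) (b : R) : Prop :=
  forall l, valid l -> forall i, Rabs (mulmx (disc_prod e l) x i ord0) <= b.

Lemma flow_prod_growth (a : R) (x : 'cV[R]_n.+1) :
  (forall A, Sx A -> forall i j, Rabs (A i j) <= a) ->
  forall l, valid l -> sqnorm (mulmx (flow_prod l) x) <= sqnorm x * exp (2 * INR n.+1 * a * dur l).
Proof.
move=> ha l; elim: l x => [|[A h] l IH] x /=.
  by rewrite mul1mx Rmult_0_r exp_0; lra.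
move=> [hA h0 vl]; rewrite -mulmxA; apply: Rle_trans (IH _ vl) _.
have dx : mderives (fun t => mulmx (E A t) x) (fun t => mulmx A (mulmx (E A t) x)).
  by apply: mderives_eq (mderives_mulr x (dE hA)) _ _ => t //; rewrite mulmxA.
have := sqnorm_growth (ha A hA) dx (Rlt_le _ _ h0); rewrite E0 // mul1mx => h1.
rewrite Rmult_plus_distr_l exp_plus -Rmult_assoc.
by apply: Rmult_le_compat_r => //; exact: Rlt_le (exp_pos _).
Qed.

Section Unbounded.
Variables (e : R) (x : 'cV[R]_n.+1).
Hypothesis unb : forall l, valid l -> forall K,
  exists l', [/\ valid (l ++ l'), (0 < size l')%nat &
    exists i, K < Rabs (mulmx (disc_prod e (l ++ l')) x i ord0)].

(** Ever longer extensions [L m] of one another, each with a coordinate above the next threshold,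
    are read as a single infinite sequence. *)
Lemma unbounded_pieces : exists u : nat -> piece,
  (forall k, Sx (u k).1 /\ 0 < (u k).2) /\
  forall m : nat, exists k i, INR m < Rabs (mulmx (disc_prod e (mkseq u k)) x i ord0).
Proof.
have [nx hnx] : exists nx : seq piece * R -> seq piece, forall p, valid p.1 ->
    [/\ valid (p.1 ++ nx p), (0 < size (nx p))%nat &
    exists i, p.2 < Rabs (mulmx (disc_prod e (p.1 ++ nx p)) x i ord0)].
  apply: (functional_choice (fun (p : seq piece * R) l' => valid p.1 ->
    [/\ valid (p.1 ++ l'), (0 < size l')%nat &
    exists i, p.2 < Rabs (mulmx (disc_prod e (p.1 ++ l')) x i ord0)])) => -[l K].
  have [vl|nv] := classic (valid l); last by exists [::].
  by have [l' h] := unb vl K; exists l'.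
pose fix L m : seq piece := if m is m'.+1 then L m' ++ nx (L m', INR m') else [::].
have vL m : valid (L m) by elim: m => [|m IH] //=; have [] := hnx (L m, INR m) IH.
have sL m : (m <= size (L m))%nat.
  elim: m => [|m IH] //=; have [_ h _] := hnx (L m, INR m) (vL m).
  by rewrite size_cat -addn1 leq_add.
have pre m k : exists s, L (k + m)%nat = L m ++ s.
  elim: k => [|k [s IH]]; first by exists [::]; rewrite cats0.
  by exists (s ++ nx (L (k + m)%nat, INR (k + m))); rewrite /= {1}IH catA.
have prele m k : (m <= k)%nat -> exists s, L k = L m ++ s.
  by move=> /subnK <-; exact: pre.
(* This default is never read, since [L k.+1] has at least [k + 1] pieces. *)
pose p0 : piece := (GRing.zero, 0).
pose u k := nth p0 (L k.+1) k.
have uE m k : (k < size (L m))%nat -> nth p0 (L m) k = u k.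
  move=> hk; rewrite /u; case: (leqP m k.+1) => h.
    by have [s ->] := prele _ _ h; rewrite nth_cat hk.
  by have [s ->] := prele _ _ (ltnW h); rewrite nth_cat (sL k.+1).
have LE m : L m = mkseq u (size (L m)).
  apply: (@eq_from_nth _ p0); first by rewrite size_mkseq.
  by move=> i hi; rewrite nth_mkseq // uE.
exists u; split=> [k|m]; first by apply: valid_nth => //; exact: sL.
have [_ _ [i hi]] := hnx (L m, INR m) (vL m).
by exists (size (L m.+1)), i; rewrite -LE.
Qed.

Lemma unbounded_trajectory (a alpha : R) :
  (forall A, Sx A -> forall i j, Rabs (A i j) <= a) -> 0 <= e -> alpha <= - e ->
  exists2 xi, trajectory Sx xi &
    ~ exists C, forall t, 0 <= t -> vnorm (xi t) <= C * exp (alpha * t).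
Proof.
move=> ha e0 ae; have [u [hu big]] := unbounded_pieces.
pose T k := dur (mkseq u k).
have vu k : valid (mkseq u k).
  rewrite /mkseq; elim: (seq.iota 0 k) => [|j s IH] //=.
  by split=> //; [exact: (proj1 (hu j)) | exact: (proj2 (hu j))].
have mkS k : mkseq u k.+1 = mkseq u k ++ [:: u k].
  by rewrite /mkseq -addn1 iotaD map_cat.
have TS k : T k.+1 = T k + (u k).2 by rewrite /T mkS dur_cat /=; lra.
have T_lt k : T k < T k.+1 by rewrite TS; have := proj2 (hu k); lra.
pose EE k := E (u k).1.
have orb k : switched_state T EE x k = mulmx (flow_prod (mkseq u k)) x.
  elim: k => [|k IH]; first by rewrite /= mul1mx.
  rewrite mkS flow_prod_cat [LHS]/= IH [flow_prod [:: _]]/= mul1mx mulmxA; congr (mulmx (mulmx _ _) _).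
  by rewrite /EE TS; congr E; ring.
(* The pieces might have finite total duration; but then the growth estimate would bound all states,
   against [big]. *)
have T_unb B : exists k, B < T k.
  apply: NNPP => nB.
  have TB k : T k <= B by apply: Rnot_lt_le => h; apply: nB; exists k.
  pose c := 2 * INR n.+1 * a.
  have c0 : 0 <= c.
    have a0 : 0 <= a by apply: Rle_trans (ha _ (proj1 (hu 0%nat)) ord0 ord0); exact: Rabs_pos.
    by apply: Rmult_le_pos => //; apply: Rmult_le_pos; [lra | exact: pos_INR].
  pose bnd := exp (2 * e * B) * (sqnorm x * exp (c * B)).
  have [m [_ hm]] := nfloor_ex (Rabs bnd) (Rabs_pos _).
  have [k [i hi]] := big m.+1.
  rewrite S_INR in hi; have mb : Rabs bnd < INR m + 1 by lra.
  have m0 := pos_INR m.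
  move: hi; rewrite disc_prod_coord Rabs_mult (Rabs_pos_eq (exp _)); last exact: Rlt_le (exp_pos _).
  set w := mulmx _ _ i ord0; set ex := exp _ => hi.
  have exB : ex * ex <= exp (2 * e * B).
    rewrite /ex -exp_plus; have -> : e * dur (mkseq u k) + e * dur (mkseq u k) = 2 * e * T k by rewrite /T; ring.
    by apply: exp_mono; apply: Rmult_le_compat_l => //; lra.
  have wB : w * w <= sqnorm x * exp (c * B).
    apply: Rle_trans (sqnorm_coord _ i) _; apply: Rle_trans (flow_prod_growth x ha (vu k)) _.
    apply: Rmult_le_compat_l; first exact: sqnorm_ge0.
    by apply: exp_mono; rewrite -/c; apply: Rmult_le_compat_l => //; exact: TB.
  have sq : (ex * Rabs w) * (ex * Rabs w) <= bnd.
    have -> : (ex * Rabs w) * (ex * Rabs w) = (ex * ex) * (w * w).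
      by have := Rsqr_abs w; rewrite /Rsqr => h; rewrite h; ring.
    by apply: Rmult_le_compat => //; [apply: Rmult_le_pos; exact: Rlt_le (exp_pos _) | exact: Rle_0_sqr].
  have h1 : 1 < ex * Rabs w by lra.
  have h2 := Rmult_lt_compat_l (ex * Rabs w) _ _ ltac:(lra) h1.
  by have := Rle_abs bnd; lra.
have [xi tr hxi] := @piecewise_trajectory T erefl T_lt T_unb n.+1 Sx (fun k => (u k).1) EE x
  (fun k => proj1 (hu k)) (fun k => E0 (proj1 (hu k))) (fun k => dE (proj1 (hu k))).
exists xi => // -[C hC].
have [m [_ hm]] := nfloor_ex (Rabs C) (Rabs_pos _).
have [k [i hi]] := big m.+1; rewrite S_INR in hi.
have Tk : 0 <= T k by exact: dur_ge0.
have := hC (T k) Tk.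
have h1 : Rabs (xi (T k) i) <= vnorm (xi (T k)).
  rewrite -sqrt_Rsqr_abs; apply: sqrt_le_1_alt; rewrite /Rsqr (bigD1 i) //=.
  set s := \big[_/_]_(_ | _) _; suff : 0 <= s by lra.
  by apply: (big_ind (Rle 0)) => [|p q hp hq|j _]; [lra | lra | exact: Rle_0_sqr].
rewrite hxi orb in h1 => h2.
move: hi; rewrite disc_prod_coord Rabs_mult (Rabs_pos_eq (exp _)); last exact: Rlt_le (exp_pos _).
rewrite -/(T k) => hi.
have h3 := Rmult_le_compat_l _ _ _ (Rlt_le _ _ (exp_pos (e * T k))) (Rle_trans _ _ _ h1 h2).
have {hi h3} h4 := Rlt_le_trans _ _ _ hi h3.
have e1 : exp (e * T k) * (C * exp (alpha * T k)) = C * exp ((e + alpha) * T k).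
  by rewrite Rmult_plus_distr_r exp_plus; ring.
have e2 : exp ((e + alpha) * T k) <= 1.
  rewrite -exp_0; apply: exp_mono.
  have := Rmult_le_compat_r _ _ _ Tk (_ : e + alpha <= 0); rewrite Rmult_0_l; apply; lra.
have := Rmult_le_compat_l _ _ _ (Rabs_pos C) e2.
have := Rmult_le_compat_r _ _ _ (Rlt_le _ _ (exp_pos ((e + alpha) * T k))) (Rle_abs C).
lra.
Qed.

End Unbounded.

(* The points with bounded orbits form an invariant subspace [V].  The flows are
   invertible, so an orbit starting outside [V] stays outside and can be made large again
   and again. *)
Lemma all_orbits_bounded (e a alpha : R) :
  (forall A, Sx A -> forall i j, Rabs (A i j) <= a) -> 0 <= e -> alpha <= - e ->
  (forall xi, trajectory Sx xi ->
     exists C, forall t, 0 <= t -> vnorm (xi t) <= C * exp (alpha * t)) ->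
  forall x, exists b, orbit_bound e x b.
Proof.
move=> ha e0 ae htr x; apply: NNPP => nx.
pose V y := exists b, orbit_bound e y b.
have V0 : V GRing.zero.
  by exists 0 => l _ i; rewrite mulmx0 mxE Rabs_R0; lra.
have Vlin c y z : V y -> V z -> V (GRing.add (GRing.scale c y) z).
  move=> [b hb] [b' hb']; exists (Rabs c * b + b') => l vl i.
  rewrite mulmxDr -scalemxAr 2!mxE; apply: Rle_trans (Rabs_triang _ _) _.
  apply: Rplus_le_compat; last exact: hb'.
  by rewrite Rabs_mult; apply: Rmult_le_compat_l; [exact: Rabs_pos | exact: hb].
have Vflow A h y : Sx A -> 0 < h -> V y -> V (mulmx (E A h) y).
  move=> hA h0 [b hb]; exists (exp (- (e * h)) * b) => l vl i.
  have := hb ((A, h) :: l) (And3 hA h0 vl) i.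
  rewrite !disc_prod_coord /= -mulmxA Rmult_plus_distr_l exp_plus !Rabs_mult.
  rewrite !(Rabs_pos_eq (exp _)); try exact: Rlt_le (exp_pos _).
  move=> h1; have := Rmult_le_compat_l _ _ _ (Rlt_le _ _ (exp_pos (- (e * h)))) h1.
  by rewrite -!Rmult_assoc -exp_plus Rplus_opp_l exp_0; lra.
have nV l : valid l -> ~ V (mulmx (flow_prod l) x).
  elim/last_ind: l => [|l [A h] IH]; first by rewrite /= mul1mx => _ [b hb]; case: nx; exists b.
  rewrite -cats1 => /valid_cat [vl [hA h0 _]]; rewrite flow_prod_cat /= mul1mx -mulmxA => hV.
  apply: (IH vl); apply: (invariant_preimage V0 Vlin _ _ hV).
    exact: flow_unit (E0 hA) (dE hA) (Rlt_le _ _ h0).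
  by move=> y; exact: Vflow.
have unb l : valid l -> forall K, exists l', [/\ valid (l ++ l'), (0 < size l')%nat &
    exists i, K < Rabs (mulmx (disc_prod e (l ++ l')) x i ord0)].
  move=> vl K; apply: NNPP => hno; apply: (nV l vl).
  pose w := mulmx (disc_prod e l) x.
  (* The sum covers the empty continuation, which [unb] excludes; [K] covers all others. *)
  have hw : orbit_bound e w (Rabs K + \big[Rplus/R0]_i Rabs (w i ord0)).
    move=> l' vl' i.
    have s0 : 0 <= \big[Rplus/R0]_i Rabs (w i ord0) by apply: Rsum_ge0 => j; exact: Rabs_pos.
    case: l' vl' => [|p l'] vl'.
      rewrite /disc_prod /= Rmult_0_r exp_0 GRing.scale1r mul1mx (bigD1 i) //=.
      set s := \big[_/_]_(_ | _) _; have := Rabs_pos K; suff : 0 <= s by lra.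
      by apply: (big_ind (Rle 0)) => [|? ? ? ?|j _]; [lra | lra | exact: Rabs_pos].
    apply: Rnot_lt_le => hlt; apply: hno; exists (p :: l'); split => //.
      by apply/valid_cat.
    by exists i; rewrite disc_prod_cat -mulmxA; apply: Rle_lt_trans hlt; have := Rle_abs K; lra.
  have -> : mulmx (flow_prod l) x = GRing.add (GRing.scale (exp (- (e * dur l))) w) GRing.zero.
    rewrite GRing.addr0 /w /disc_prod -scalemxAl GRing.scalerA.
    change (mulmx (flow_prod l) x = GRing.scale (Rmult (exp (- (e * dur l))) (exp (e * dur l))) (mulmx (flow_prod l) x)).
    by rewrite -exp_plus Rplus_opp_l exp_0 GRing.scale1r.
  by apply: Vlin => //; eexists; exact: hw.
have [xi tr nb] := unbounded_trajectory unb ha e0 ae.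
by apply: nb; exact: htr.
Qed.

(** In finite dimension, orbit bounds for the basis vectors bound all columns at once. *)
Lemma uniform_bound (e : R) : (forall x, exists b, orbit_bound e x b) ->
  exists2 K, 0 < K & forall l, valid l -> forall i j, Rabs (disc_prod e l i j) <= K.
Proof.
move=> h; have /fin_all_exists [b hb] (j : 'I_n.+1) : exists b, orbit_bound e (delta_mx j ord0) b by exact: h.
exists (1 + \big[Rplus/R0]_j Rabs (b j)).
  by have := @Rsum_ge0 _ (fun j => Rabs (b j)) (fun j => Rabs_pos _); lra.
move=> l vl i j; have := hb j l vl i; rewrite -colE mxE => h1.
apply: Rle_trans h1 _; rewrite (bigD1 j) //=; set s := \big[_/_]_(_ | _) _.
have : 0 <= s by apply: (big_ind (Rle 0)) => [|? ? ? ?|k _]; [lra | lra | exact: Rabs_pos].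
by have := Rle_abs (b j); lra.
Qed.

(** A constant choice of [A] is a valid product, and a left eigenvector [v] satisfies
    [v E(t) = exp (lam t) v]. Boundedness of [exp ((e + lam) t)] forces [e + lam <= 0]. *)
Lemma eigenvalue_le (e K : R) (A : 'M[R]_n.+1) (lam : 'I_n.+1 -> R) (i : 'I_n.+1) :
  (forall l, valid l -> forall i j, Rabs (disc_prod e l i j) <= K) ->
  Sx A -> real_eigs A lam -> lam i <= - e.
Proof.
move=> hK hA hlam; have [v v0 vA] := left_eigenvector i hlam.
have [j vj] : exists j, v ord0 j <> 0.
  apply: NNPP => h; case/negP: v0; apply/eqP/matrixP => k j; rewrite [RHS]mxE.
  have -> : k = ord0 by rewrite ord1; apply: val_inj.
  by apply: NNPP => vj; apply: h; exists j.
pose f t := mulmx v (E A t) ord0 j.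
have df : derives f (fun t => lam i * f t).
  apply: derives_eq (mderives_mull v (dE hA) ord0 j) _ _ => t //.
  by rewrite mulmxA vA -scalemxAl mxE.
have fE t : f t = exp (lam i * t) * v ord0 j.
  have dF : derives (fun t => exp (- lam i * t) * f t) (fun=> 0).
    by move=> s; apply: is_derive_eq (derives_mul (derives_exp (- lam i)) df s) _; ring.
  have := derives0_const dF t 0; rewrite Rmult_0_r exp_0 /f E0 // mulmx1 Rmult_1_l => <-.
  rewrite -Rmult_assoc -exp_plus; have -> : lam i * t + - lam i * t = 0 by ring.
  by rewrite exp_0; lra.
apply: Rnot_lt_le => hlt; pose g := e + lam i; have g0 : 0 < g by rewrite /g; lra.
pose W := \big[Rplus/R0]_k (Rabs (v ord0 k) * K).
have hW t : 0 < t -> exp (g * t) * Rabs (v ord0 j) <= W.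
  move=> t0.
  have -> : exp (g * t) * Rabs (v ord0 j) = Rabs (mulmx v (disc_prod e [:: (A, t)]) ord0 j).
    rewrite /disc_prod /= mul1mx -scalemxAr mxE -/(f t) fE.
    change (exp (g * t) * Rabs (v ord0 j) = Rabs (exp (e * (t + 0)) * (exp (lam i * t) * v ord0 j))).
    rewrite -Rmult_assoc -exp_plus Rabs_mult (Rabs_pos_eq (exp _)); last exact: Rlt_le (exp_pos _).
    by congr (exp _ * _); rewrite /g; ring.
  rewrite mxE; apply: Rle_trans (Rabs_sum_le _) _; apply: Rsum_le => k; rewrite Rabs_mult.
  by apply: Rmult_le_compat_l; [exact: Rabs_pos | exact: (hK [:: (A, t)])].
have vp : 0 < Rabs (v ord0 j) by exact: Rabs_pos_lt.
(* At this time [g t |v_j| = |W| + 1], so [exp (g t) >= 1 + g t] breaks the bound [W]. *)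
pose t := (Rabs W + 1) / (g * Rabs (v ord0 j)).
have gv := Rmult_lt_0_compat _ _ g0 vp.
have W0 := Rabs_pos W.
have t0 : 0 < t by apply: Rdiv_lt_0_compat; lra.
have := hW t t0; have := exp_ineq1_le (g * t) => h1.
have := Rmult_le_compat_r _ _ _ (Rlt_le _ _ vp) h1.
have -> : (1 + g * t) * Rabs (v ord0 j) = Rabs (v ord0 j) + (Rabs W + 1) by rewrite /t; field; lra.
by have := Rle_abs W; lra.
Qed.

Lemma contraction (e b M sigma tau : R) (A : 'M[R]_n.+1) (l0 : seq R) (x : 'cV[R]_n.+1) :
  0 < b -> 0 < sigma -> 0 <= e -> Sx A ->
  (forall i j, expsol l0 (fun t => E A t i j)) ->
  second_bound [seq c - e | c <- l0] M -> tau * (1 + sigma * e) = sigma ->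
  orbit_bound e x b ->
  orbit_bound e (mulmx (I_plus tau A) x) ((1 + sigma * sigma * M / 2) / (1 + sigma * e) * b).
Proof.
move=> b0 s0 e0 hA hE bM tauE hx l vl i.
have se : 0 < 1 + sigma * e by have := Rmult_le_pos sigma e (Rlt_le _ _ s0) e0; lra.
pose P := disc_prod e l.
pose y t := mulmx P (mulmx (E A t) x) i ord0.
pose y' t := mulmx P (mulmx (mulmx A (E A t)) x) i ord0.
have dy : derives y y' by exact: (mderives_mull P (mderives_mulr x (dE hA))).
have sy : expsol l0 y.
  have h1 j : expsol l0 (fun t => mulmx (E A t) x j ord0).
    apply: chain_eq (expsol_comb (fun k => x k ord0) (hE j)) _ _ => t //.
    by rewrite /comb mxE; apply: eq_bigr => k _; exact: Rmult_comm.
  apply: chain_eq (expsol_comb (fun j => P i j) h1) _ _ => t //.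
  by rewrite /comb /y mxE.
pose q t := exp (e * t) * y t.
have sq : expsol [seq c - e | c <- l0] q := expsol_expmul e sy.
have dq := derives_mul (derives_exp e) dy.
(* Running [A] for time [t] before [l] is again a valid product. Time 0 is separate because pieces
   have positive duration. *)
have qb t : 0 <= t -> Rabs (q t) <= b.
  move=> [t0|<-]; last first.
    by rewrite /q /y Rmult_0_r exp_0 Rmult_1_l E0 // mul1mx; exact: hx.
  have := hx ((A, t) :: l) (And3 hA t0 vl) i; congr (Rabs _ <= _).
  rewrite disc_prod_coord /q /y /P disc_prod_coord /= -mulmxA Rmult_plus_distr_l exp_plus; ring.
have := taylor_bound bM b0 s0 sq dq qb.
have -> : q 0 + sigma * (e * exp (e * 0) * y 0 + exp (e * 0) * y' 0) =
    (1 + sigma * e) * mulmx P (mulmx (I_plus tau A) x) i ord0.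
  have IE : I_plus tau A = GRing.add (scalar_mx 1) (GRing.scale tau A).
    by apply/matrixP => j k; rewrite mxE defs_mxid !mxE.
  rewrite /q Rmult_0_r exp_0 IE mulmxDl mul1mx -scalemxAl mulmxDr -scalemxAr.
  rewrite [fun_of_matrix (GRing.add _ _) i ord0]mxE [fun_of_matrix (GRing.scale _ _) i ord0]mxE /y /y' E0 // mul1mx mulmx1.
  set p := mulmx P x i ord0; set p' := mulmx P (mulmx A x) i ord0.
  change (1 * p + sigma * (e * 1 * p + 1 * p') = (1 + sigma * e) * (p + tau * p')).
  have -> : (1 + sigma * e) * (p + tau * p') = (1 + sigma * e) * p + tau * (1 + sigma * e) * p' by ring.
  by rewrite tauE; ring.
rewrite Rabs_mult (Rabs_pos_eq (1 + _)); last by lra.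
move=> h; apply: (Rmult_le_reg_l (1 + sigma * e)) => //.
by apply: Rle_trans h _; right; field; lra.
Qed.

End Family.

(** * Choice of the step and contraction of the discrete system *)

Lemma compact_bounded (d : nat) (Sx : 'M[R]_d -> Prop) : mx_compact Sx ->
  exists a, forall A, Sx A -> forall i j, Rabs (A i j) <= a.
Proof.
move=> cS; apply: NNPP => nb.
have [An hAn] : exists An : nat -> 'M[R]_d, forall m, Sx (An m) /\
    exists i j, INR m < Rabs (An m i j).
  apply: (functional_choice (fun m A => Sx A /\ exists i j, INR m < Rabs (A i j))) => m.
  apply: NNPP => h; apply: nb; exists (INR m) => A hA i j; apply: Rnot_lt_le => hlt.
  by apply: h; exists A; split => //; exists i, j.
have [phi [A [phi_lt [_ cv]]]] := cS An (fun m => proj1 (hAn m)).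
have phi_ge m : (m <= phi m)%nat by elim: m => [|m IH] //; exact: leq_ltn_trans IH (phi_lt m).
have /fin_all_exists [N hN] i : exists N, forall j n, (N <= n)%nat -> Rabs (An (phi n) i j) < Rabs (A i j) + 1.
  have /fin_all_exists [N hN] j : exists N, forall n, (N <= n)%nat -> Rabs (An (phi n) i j) < Rabs (A i j) + 1.
    have [N hN] := cv i j 1 Rlt_0_1; exists N => n Nn.
    have := hN n (elimT leP Nn); rewrite /R_dist => h.
    by have := Rabs_triang (An (phi n) i j - A i j) (A i j); rewrite Rplus_assoc Rplus_opp_l Rplus_0_r; rewrite /Rdist in h; lra.
  exists (\sum_j N j)%nat => j n hn; apply: hN; apply: leq_trans hn.
  by rewrite (bigD1 j) //= leq_addr.
pose B := \big[Rplus/R0]_i \big[Rplus/R0]_j Rabs (A i j).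
have [m [_ hm]] := nfloor_ex (Rabs B) (Rabs_pos _).
pose n := (\sum_i N i + m.+2)%nat.
have [_ [i [j hij]]] := hAn (phi n).
have h1 : Rabs (An (phi n) i j) < Rabs (A i j) + 1.
  by apply: hN; rewrite /n (bigD1 i) //= -addnA leq_addr.
have h2 : INR m.+2 <= INR (phi n).
  by apply: le_INR; apply/leP; apply: leq_trans (phi_ge n); rewrite /n leq_addl.
have h3 : Rabs (A i j) <= B.
  rewrite /B (bigD1 i) //= (bigD1 j) //=.
  set s1 := \big[_/_]_(_ | _) _; set s2 := \big[_/_]_(_ | _) _.
  have : 0 <= s1 by apply: (big_ind (Rle 0)) => [|u v hu hv|k _]; [lra | lra | exact: Rabs_pos].
  have : 0 <= s2.
    apply: (big_ind (Rle 0)) => [|u v hu hv|k _]; [lra | lra | apply: Rsum_ge0 => ?; exact: Rabs_pos].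
  lra.
rewrite !S_INR in h2; have := Rle_abs B; lra.
Qed.

(** Solving for [sigma] gives [tau / (1 - tau eps)]; [2 <= M] and [eps < r] make the denominator
    positive. With [X = M (r - eps)^2], the factor is below 1 exactly when [sigma X < 2 eps]. *)
Lemma contraction_factor (r eps M tau : R) : 0 < eps < r -> 2 <= M -> 0 < tau ->
  tau * (M * (r * r)) < 2 * eps ->
  exists sigma, [/\ 0 < sigma, tau * (1 + sigma * eps) = sigma &
    (1 + sigma * sigma * (M * ((r - eps) * (r - eps))) / 2) / (1 + sigma * eps) < 1].
Proof.
move=> [e0 er] M2 t0 ht; have r0 : 0 < r by lra.
have rr := Rmult_lt_0_compat _ _ r0 r0.
have trr := Rmult_lt_0_compat _ _ t0 rr.
have te : 0 < 1 - tau * eps.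
  have h1 : tau * (r * r) < eps.
    have := Rmult_le_compat_r _ _ _ (Rlt_le _ _ trr) M2; lra.
  have h2 : eps * eps < r * r by apply: Rmult_gt_0_lt_compat => //; lra.
  have h3 := Rmult_lt_compat_r _ _ _ e0 h1.
  have h4 : tau * eps * (r * r) < 1 * (r * r) by lra.
  by have := Rmult_lt_reg_r _ _ _ rr h4; lra.
exists (tau / (1 - tau * eps)); set sigma := tau / _.
have s0 : 0 < sigma by exact: Rdiv_lt_0_compat.
have se := Rmult_lt_0_compat _ _ s0 e0.
have sE : sigma * (1 - tau * eps) = tau by rewrite /sigma; field; lra.
split => //; first by lra.
apply: (Rmult_lt_reg_r (1 + sigma * eps)); first by lra.
set X := M * _; have -> : (1 + sigma * sigma * X / 2) / (1 + sigma * eps) * (1 + sigma * eps) =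
  1 + sigma * sigma * X / 2 by field; lra.
suff h : sigma * X < 2 * eps.
  by have := Rmult_lt_compat_l _ _ _ s0 h; lra.
apply: (Rmult_lt_reg_r (1 - tau * eps)) => //.
have -> : sigma * X * (1 - tau * eps) = tau * X by rewrite -[in RHS]sE; ring.
(* It remains to see [X + 2 eps^2 <= M r^2], that is, [M eps (2 r - eps) >= 2 eps^2]; this follows
   from [M >= 2] and [r >= eps]. *)
suff : tau * (X + 2 * (eps * eps)) < 2 * eps by lra.
apply: Rle_lt_trans ht; apply: Rmult_le_compat_l; first by lra.
have h1 : 0 <= eps * (2 * r - eps) by apply: Rmult_le_pos; lra.
have h2 := Rmult_le_compat_r _ _ _ h1 M2.
have h3 : 0 <= eps * (r - eps) by apply: Rmult_le_pos; lra.
rewrite /X; lra.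
Qed.

Lemma real_eigs1 (A : 'M[R]_1) (lam : 'I_1 -> R) : real_eigs A lam -> A = scalar_mx (lam ord0).
Proof.
move=> h; have := h 0; rewrite defs_det det_mx11 !mxE /= big_ord1 => e.
have {}e : A ord0 ord0 = lam ord0 by change (0 * R1 - A ord0 ord0 = 0 - lam ord0) in e; lra.
by rewrite [A]mx11_scalar; congr scalar_mx; exact: e.
Qed.

Lemma orbit_boundZ (n : nat) (Sx : 'M[R]_n.+1 -> Prop) (E : 'M[R]_n.+1 -> R -> 'M[R]_n.+1)
    (e c b b' : R) (x : 'cV[R]_n.+1) : Rabs c * b <= b' ->
  orbit_bound Sx E e x b -> orbit_bound Sx E e (GRing.scale c x) b'.
Proof.
move=> hb hx l vl i; apply: Rle_trans hb; rewrite -scalemxAr mxE.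
change (Rabs (c * mulmx (disc_prod E e l) x i ord0) <= Rabs c * b); rewrite Rabs_mult.
by apply: Rmult_le_compat_l; [exact: Rabs_pos | exact: hx].
Qed.

Lemma uniform_contraction (n : nat) (Sx : 'M[R]_n.+1 -> Prop)
    (E : 'M[R]_n.+1 -> R -> 'M[R]_n.+1) (lam : 'M[R]_n.+1 -> 'I_n.+1 -> R)
    (r eps alpha M2 tau : R) :
  (forall A, Sx A -> E A 0 = scalar_mx 1) ->
  (forall A, Sx A -> mderives (E A) (fun t => mulmx A (E A t))) ->
  (forall A, Sx A -> real_eigs A (lam A)) ->
  (forall A, Sx A -> forall i, - r <= lam A i <= alpha) ->
  (forall A, Sx A -> forall i j,
     expsol [seq - lam A k | k <- enum 'I_n.+1] (fun t => E A t i j)) ->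
  alpha < - eps -> 0 < eps -> 0 < tau -> is_lub (M2_set n.+1) M2 ->
  tau < 2 * eps / (M2 * (r * r)) ->
  exists2 theta, 0 < theta < 1 & forall A, Sx A -> forall x b, 0 < b ->
    orbit_bound Sx E eps x b -> orbit_bound Sx E eps (mulmx (I_plus tau A) x) (theta * b).
Proof.
move=> hE0 hdE heig hlam hexp ae e0 t0 lub ht.
have [[A0 hA0]|nA] := classic (exists A, Sx A); last first.
  by exists (/ 2); [lra | move=> A hA; case: nA; exists A].
have er : eps < r by have := hlam A0 hA0 ord0; lra.
have M1 := M2_ge1 lub.
have rr : 0 < r * r by apply: Rmult_lt_0_compat; lra.
have Mrr : 0 < M2 * (r * r) by apply: Rmult_lt_0_compat; lra.
have {}ht : tau * (M2 * (r * r)) < 2 * eps.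
  have := Rmult_lt_compat_r _ _ _ Mrr ht.
  by have -> : 2 * eps / (M2 * (r * r)) * (M2 * (r * r)) = 2 * eps by [field; lra].
case: n => [|n] in Sx E lam hE0 hdE heig hlam hexp lub A0 hA0 *.
  (* Dimension 1, where only [1 <= M2] is at hand: [tau r^2 <= tau M2 r^2 < 2 eps < 2 r]. The factor
     [1 + tau lam] lies between [1 - tau r] and [1 - tau eps]; the entry [/ 2] in the maximum keeps
     [theta] positive. *)
  have tr : tau * r < 2.
    apply: (Rmult_lt_reg_r r); first by lra.
    have := Rmult_le_compat_r (tau * (r * r)) _ _ ltac:(apply: Rmult_le_pos; lra) M1; lra.
  exists (Rmax (1 - tau * eps) (Rmax (tau * r - 1) (/ 2))).
    have te := Rmult_lt_0_compat _ _ t0 e0.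
    split; last by apply: Rmax_lub_lt; [lra | apply: Rmax_lub_lt; lra].
    apply: Rlt_le_trans (Rmax_r _ _); apply: Rlt_le_trans (Rmax_r _ _); lra.
  set theta := Rmax _ _ => A hA x b b0 hx.
  pose c := 1 + tau * lam A ord0.
  have -> : mulmx (I_plus tau A) x = GRing.scale c x.
    have {1}-> := real_eigs1 (heig A hA); rewrite -mul_scalar_mx; congr mulmx.
    apply/matrixP => i j; rewrite !mxE.
    by have [-> ->] : i = ord0 /\ j = ord0 by [split; rewrite ord1; apply: val_inj].
  apply: orbit_boundZ hx; apply: Rmult_le_compat_r; first by lra.
  have [l1 l2] := hlam A hA ord0.
  have m1 := Rmax_l (1 - tau * eps) (Rmax (tau * r - 1) (/ 2)).
  have m2 := Rle_trans _ _ _ (Rmax_l (tau * r - 1) (/ 2)) (Rmax_r (1 - tau * eps) _).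
  rewrite -/theta in m1 m2.
  have := Rmult_le_compat_l _ _ _ (Rlt_le _ _ t0) l1.
  have := Rmult_le_compat_l _ _ _ (Rlt_le _ _ t0) (Rle_trans _ _ _ l2 (Rlt_le _ _ ae)).
  by move=> h1 h2; apply: Rabs_le; rewrite /c; lra.
have M3 := M2_ge3 lub.
have M2ge2 : 2 <= M2 by lra.
have [sigma [s0 sE th]] := contraction_factor (conj e0 er) M2ge2 t0 ht.
set theta := _ / _ in th.
have RR : 0 < (r - eps) * (r - eps) by apply: Rmult_lt_0_compat; lra.
have se := Rmult_lt_0_compat _ _ s0 e0.
exists theta.
  split => //; apply: Rdiv_lt_0_compat; last by lra.
  have := Rmult_lt_0_compat _ _ (Rmult_lt_0_compat _ _ s0 s0) (Rmult_lt_0_compat M2 _ ltac:(lra) RR); lra.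
move=> A hA x b b0 hx.
apply: (contraction hE0 hdE b0 s0 (Rlt_le _ _ e0) hA (hexp A hA)) => //.
(* The shifted rates are at least [- alpha - eps > 0]; halving makes the lower bound strict. *)
apply: (@second_bound_all _ (r - eps) ((- alpha - eps) / 2)); first by lra.
  move=> c /mapP [c' /mapP [k _ ->] ->]; have := hlam A hA k; lra.
rewrite 2!size_map size_enum_ord; apply: second_bound_nseq => //; lra.
Qed.

Theorem theorem3 (d : nat) (r eps : R) (M2 : R) (tau : R)
  (Aset : 'M[R]_d -> Prop) :
  0 < r -> 0 < eps ->
  is_lub (M2_set d) M2 ->
  0 < tau -> tau < 2 * eps / (M2 * (r * r)) ->
  mx_compact Aset ->
  (forall A, Aset A -> exists lam, real_eigs A lam /\ forall i, Rabs (lam i) <= r) ->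
  (exists L, jsr_is (I_plus_set tau Aset) L /\ 1 <= L) ->
  lyap_ge Aset (- eps).
Proof.
move=> r0 e0 lub t0 ht cA eigs [L [jsr L1]] alpha htr.
apply: Rnot_lt_le => ae; suff : L < 1 by lra.
case: d => [|n] in Aset lub cA eigs jsr htr *.
  by apply: (@geometric_jsr_lt1 _ _ 1 (/ 2)) jsr => //; [lra | lra | move=> l _ []].
have [lam hlam] : exists lam : 'M[R]_n.+1 -> 'I_n.+1 -> R, forall A, Aset A ->
    real_eigs A (lam A) /\ forall i, Rabs (lam A i) <= r.
  apply: (functional_choice (fun A lam => Aset A -> real_eigs A lam /\ forall i, Rabs (lam i) <= r)) => A.
  have [/eigs [lam h]|nA] := classic (Aset A); first by exists lam.
  by exists (fun=> 0).
have [E hE] : exists E : 'M[R]_n.+1 -> R -> 'M[R]_n.+1, forall A, Aset A ->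
    [/\ E A 0 = scalar_mx 1, mderives (E A) (fun t => mulmx A (E A t)) &
    forall i j, expsol [seq - lam A k | k <- enum 'I_n.+1] (fun t => E A t i j)].
  apply: (functional_choice (fun A E => Aset A -> [/\ E 0 = scalar_mx 1,
    mderives E (fun t => mulmx A (E t)) &
    forall i j, expsol [seq - lam A k | k <- enum 'I_n.+1] (fun t => E t i j)])) => A.
  have [hA|nA] := classic (Aset A); last by exists (fun=> GRing.zero).
  by have [E hE] := eigs_flow (proj1 (hlam A hA)); exists E.
have E0 A : Aset A -> E A 0 = scalar_mx 1 by move=> /hE [].
have dE A : Aset A -> mderives (E A) (fun t => mulmx A (E A t)) by move=> /hE [].
have [a ha] := compact_bounded cA.
have bnd e : 0 <= e -> alpha <= - e -> exists2 K, 0 < K &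
    forall l, valid Aset l -> forall i j, Rabs (disc_prod E e l i j) <= K.
  move=> he hae; have [K K0 hK] := uniform_bound (all_orbits_bounded E0 dE ha he hae htr).
  by exists K.
(* The discount [- alpha] gives [lam <= alpha], strictly below [- eps]; the discount [eps] gives the
   norm to be contracted. *)
have [K' _ hK'] := bnd (- alpha) ltac:(lra) ltac:(lra).
have [K K0 hK] := bnd eps ltac:(lra) ltac:(lra).
have lam_bnd A : Aset A -> forall i, - r <= lam A i <= alpha.
  move=> hA i; have [h1 h2] := hlam A hA.
  have := eigenvalue_le E0 dE i hK' hA h1; rewrite Ropp_involutive => h3.
  by have := h2 i; move: (Rle_abs (- lam A i)); rewrite Rabs_Ropp; lra.
have [theta th contr] := uniform_contraction E0 dE (fun A hA => proj1 (hlam A hA)) lam_bnd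
  (fun A hA => let: And3 _ _ h := hE A hA in h) ae e0 t0 lub ht.
apply: (geometric_jsr_lt1 th K0 _ jsr) => l hl i j.
(* Each factor contracts the adapted norm by [theta], starting from a basis vector of norm at most
   [K]. The empty product of flows then reads off the matrix entry. *)
have iter : orbit_bound Aset E eps (mulmx (mxprod l) (delta_mx j ord0)) (theta ^ length l * K).
  elim: l hl => [|M l IH] hl.
    rewrite /= defs_mxid mul1mx Rmult_1_l => l' vl' k.
    by rewrite -colE mxE; exact: hK.
  have [A [hA MA]] := hl M (or_introl erefl).
  rewrite /= defs_mxmul -mulmxA MA Rmult_assoc; apply: contr => //.
    by apply: Rmult_lt_0_compat => //; apply: pow_lt; lra.
  by apply: IH => M' hM'; apply: hl; right.
have := iter [::] I i; rewrite disc_prod_coord /= Rmult_0_r exp_0 Rmult_1_l mul1mx -colE mxE.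
by rewrite (Rmult_comm K).
Qed.
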